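(* There exists a constant $C>0$ such that, for polluted modified bootstrap percolation on $\mathbb{Z}^2$ with parameters $p,q$ satisfying $q\ge C p^2/\log(1/p)$, $$\lim_{q\to 0}\mathbb{P}_{p,q}\bigl((0,0)\text{ is eventually occupied}\bigr)=0.$$ Explicitly: there is $C>0$ such that for every $\eta>0$ there is $q_0>0$ such that for all $p\in(0,1)$ and $q\in(0,q_0)$ with $p+q\le 1$ and $q\ge Cp^2/\log(1/p)$, one has $\mathbb{P}_{p,q}\bigl((0,0)\text{ is eventually occupied}\bigr)\le\eta$.
   Context: Polluted modified bootstrap percolation: each site of $\mathbb{Z}^2$ is in one of three states: occupied, closed, or open. Under $\mathbb{P}_{p,q}$ (where $p+q\le 1$), the initial states of the sites are independent, each site being occupied with probability $p$, closed with probability $q$, and open with probability $1-p-q$. The configuration then evolves deterministically in discrete time: occupied and closed sites never change state; an open site $x$ at time $t$ becomes occupied at time $t+1$ if and only if, at time $t$, at least one of its two horizontal neighbors $x\pm e_1$ is occupied and at least one of its two vertical neighbors $x\pm e_2$ is occupied. A site is eventually occupied if it is occupied at some time $t\ge 0$. Here $\log$ is the natural logarithm. *)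

(* Defs.v *)
From HB Require Import structures.
From mathcomp Require Import all_boot all_order all_algebra finmap.
From mathcomp Require Import all_classical all_reals all_analysis.

Set Implicit Arguments.
Unset Strict Implicit.
Unset Printing Implicit Defensive.

Import Order.TTheory GRing.Theory Num.Theory.
Local Open Scope classical_set_scope.
Local Open Scope ring_scope.

Inductive state := Occupied | Closed | Open.

Definition is_occupied (s : state) : bool :=
  if s is Occupied then true else false.

(* Random variables are measurable functions into a measurable type, so [state]
   carries the discrete sigma-algebra: every set of states is measurable. *)
HB.instance Definition _ := gen_eqMixin state.
HB.instance Definition _ := gen_choiceMixin state.
HB.instance Definition _ := isPointed.Build state Open.
HB.instance Definition _ := @isMeasurable.Build default_measure_display
  state (@discrete_measurable state) (@discrete_measurable0 state)
  (@discrete_measurableC state) (@discrete_measurableU state).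

Definition site := (int * int)%type.

Definition origin : site := (0, 0).

Definition configuration := site -> state.

Definition has_occupied_horizontal_neighbor (c : configuration) (x : site) : bool :=
  is_occupied (c (x.1 + 1, x.2)) || is_occupied (c (x.1 - 1, x.2)).

Definition has_occupied_vertical_neighbor (c : configuration) (x : site) : bool :=
  is_occupied (c (x.1, x.2 + 1)) || is_occupied (c (x.1, x.2 - 1)).

Definition step (c : configuration) : configuration := fun x =>
  match c x with
  | Occupied => Occupied
  | Closed => Closed
  | Open =>
      if has_occupied_horizontal_neighbor c x
         && has_occupied_vertical_neighbor c x
      then Occupied else Open
  end.

Definition eventually_occupied (c : configuration) (x : site) : Prop :=
  exists t : nat, is_occupied (iter t step c x).

Lemma measurable_eventually_occupied (d : measure_display)
    (Omega : measurableType d) (X : site -> {mfun Omega >-> state}) (x : site) :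
  measurable [set w | eventually_occupied (fun y => X y w) x].
Proof.
pose Y t y w := iter t step (fun z => X z w) y.
have mY t : forall y (B : set state), measurable (Y t y @^-1` B).
  elim: t => [|t IH] y B.
    have := measurable_funPT (X y) measurableT B I.
    by rewrite setTI.
  have mO z : measurable [set w | is_occupied (Y t z w)] by exact: (IH z [set s | is_occupied s]).
  pose N := [set w | has_occupied_horizontal_neighbor (Y t ^~ w) y && has_occupied_vertical_neighbor (Y t ^~ w) y].
  have mN : measurable N.
    have -> : N = ([set w | is_occupied (Y t (y.1 + 1, y.2) w)] `|` [set w | is_occupied (Y t (y.1 - 1, y.2) w)]) `&`
       ([set w | is_occupied (Y t (y.1, y.2 + 1) w)] `|` [set w | is_occupied (Y t (y.1, y.2 - 1) w)]).
      apply/seteqP; split => w /=.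
        by case/andP => /orP h1 /orP h2.
      by case=> h1 h2; apply/andP; split; apply/orP.
    by apply: measurableI; apply: measurableU; exact: mO.
  have -> : Y t.+1 y @^-1` B =
    (Y t y @^-1` (B `\` [set Open]) `|` ((Y t y @^-1` [set Open]) `&`
      ((N `&` [set w | B Occupied]) `|` (~` N `&` [set w | B Open])))).
    apply/seteqP; split=> w; rewrite /Y /N /= /step.
      case E: (iter t step (fun z => X z w) y) => //.
      - by move=> hB; left.
      - by move=> hB; left.
      - by case: ifP => /negP h hB; right; split => //; [left|right].
    case E: (iter t step (fun z => X z w) y).
    - by case=> [[]|[]].
    - by case=> [[]|[]].
    case=> [[_ []]//|[_ [[h ?]|[h ?]]]]; first by rewrite ifT.
    by rewrite ifF //; apply/negP.
  have mc (Q : Prop) : measurable [set w : Omega | Q].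
    have [q|q] := pselect Q.
      by rewrite (_ : [set _ | Q] = setT) //; apply/seteqP; split.
    by rewrite (_ : [set _ | Q] = set0) //; apply/seteqP; split.
  apply: measurableU; first exact: IH.
  apply: measurableI; first exact: IH.
  by apply: measurableU; apply: measurableI => //; exact: measurableC.
rewrite (_ : [set w | _] = \bigcup_t (Y t x @^-1` [set s | is_occupied s])).
  by apply: bigcupT_measurable => t; exact: mY.
apply/seteqP; split => w /=; first by case=> t ?; exists t.
by case=> t _ ?; exists t.
Qed.

Definition mutually_independent (d d' : measure_display)
    (Omega : measurableType d) (T : measurableType d') (R : realType)
    (P : probability Omega R) (I : choiceType) (X : I -> {RV P >-> T}) : Prop :=
  forall (F : {fset I}) (B : I -> set T),
    (forall i, measurable (B i)) ->
    P (\bigcap_(i in [set` F]) (X i @^-1` B i))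
    = (\prod_(i <- F) P (X i @^-1` B i))%E.

(* The law of the initial configuration under P_{p,q}.  It is given through a
   family of random states on a probability space, since the library has no
   infinite product measure; only the joint law of the family matters. *)
Definition polluted_initial_law (d : measure_display) (Omega : measurableType d)
    (R : realType) (P : probability Omega R) (p q : R)
    (X : site -> {RV P >-> state}) : Prop :=
  mutually_independent X /\
  forall x : site,
    [/\ P (X x @^-1` [set Occupied]) = p%:E,
        P (X x @^-1` [set Closed]) = q%:E
      & P (X x @^-1` [set Open]) = (1 - p - q)%:E].

(* Main.v *)
Require Import Defs.
From HB Require Import structures.
From mathcomp Require Import all_boot all_order all_algebra finmap.
From mathcomp Require Import zify ring lra.
From mathcomp Require Import all_classical all_reals all_analysis.

Set Implicit Arguments.
Unset Strict Implicit.
Unset Printing Implicit Defensive.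

Import Order.TTheory GRing.Theory Num.Theory.
Local Open Scope classical_set_scope.
Local Open Scope ring_scope.

(* Write w for 1/p and L for log(1/p).  A set V of initially unoccupied sites stays
   unoccupied as soon as each of its open sites has both horizontal or both
   vertical neighbours in V; we surround the origin by such a set.

   A left wall climbs as follows: from a closed site b an unoccupied row runs to
   the right over a length of order w, crosses a vertical unoccupied segment of
   length of order wL, which leads to the row of the next closed site b', and so
   on.  The corner between the vertical segment and the row of b' is protected
   from the left because the row continues to the left until the closed site b'.
   Among the w possible abscissae a vertical segment of length of order wL is
   easily found, so b' may be chosen in a region of area of order w^2 L: if
   q >= C p^2 / L it contains many closed sites, which is where the logarithm is
   gained.  Each block of such a region contains a suitable b' with probability
   close to 1, independently, and a Lipschitz percolation (Peierls) argument
   yields a wall of polynomial height within a strip of width of order wL.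

   At polynomial distance there are rows, spanning the strip, that are unoccupied
   with closed ends.  Two of them, a left wall and the mirror image of another
   one enclose a chamber that cannot be invaded from outside.  The origin is
   still not reached from inside: in a box of polynomial size the occupied sites
   only generate clusters of bounded diameter. *)

(** * Stable sets *)

Definition stable_set (c : configuration) (V : set site) : Prop :=
  forall x y : int, V (x, y) ->
    [/\ c (x, y) <> Occupied &
        [\/ c (x, y) = Closed, V (x - 1, y) /\ V (x + 1, y) |
            V (x, y - 1) /\ V (x, y + 1)]].

(** By induction on time, sites of [V] stay unoccupied and closed sites of [V] stay closed: an open
    site of [V] sees no occupied neighbour in one of the two directions, so the conjunction in
    [step] fails. *)
Lemma stable_not_occupied (c : configuration) (V : set site) (s : site) :
  stable_set c V -> V s -> ~ eventually_occupied c s.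
Proof.
move=> stV Vs [t]; suff inv u : forall x y, V (x, y) ->
    ~~ is_occupied (iter u step c (x, y)) /\
    (c (x, y) = Closed -> iter u step c (x, y) = Closed).
  by case: s Vs => x y Vs; apply/negP; exact: (inv t x y Vs).1.
elim: u => [|u IH] x y Vxy.
  by have [nocc _] := stV _ _ Vxy; split => //=; case: (c (x, y)) nocc.
have [_ cases] := stV _ _ Vxy; have [IH1 IH2] := IH _ _ Vxy.
rewrite /= {1 3}/step; split; last by move=> /IH2 ->.
case E : (iter u step c (x, y)) IH1 => //= _.
rewrite /has_occupied_horizontal_neighbor /has_occupied_vertical_neighbor /=.
case: cases => [/IH2|[/IH[/negPf-> _] /IH[/negPf-> _]]|[/IH[/negPf-> _] /IH[/negPf-> _]]] //=.
  by rewrite E.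
by rewrite andbF.
Qed.

(** * Clusters generated by a sparse set *)

Definition in_rect (R : int * int * int * int) (s : site) : bool :=
  let: (a, b, c, d) := R in (a <= s.1 <= b) && (c <= s.2 <= d).

Definition semiperimeter (R : int * int * int * int) : int :=
  let: (a, b, c, d) := R in (b - a) + (d - c).

Definition rect_hull (R S : int * int * int * int) : int * int * int * int :=
  let: (a, b, c, d) := R in let: (a', b', c', d') := S in
  (Num.min a a', Num.max b b', Num.min c c', Num.max d d').

Definition bootstrap_closed (K : set site) : Prop := forall x y : int,
  (K (x - 1, y) \/ K (x + 1, y)) -> (K (x, y - 1) \/ K (x, y + 1)) -> K (x, y).

Definition sparse (r : nat) (O : seq site) : Prop :=
  forall (A : seq site) R, uniq A -> {subset A <= O} -> (r <= size A)%N ->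
    all (in_rect R) A -> (4 * r)%:Z < semiperimeter R.

Definition cluster := (int * int * int * int * seq site)%type.

(* The bound relating the semiperimeter to the number of sites survives merging
   two clusters whose rectangles share a neighbour. *)
Definition tight_cluster (r : nat) (C : cluster) : bool :=
  [&& C.2 != [::], all (in_rect C.1) C.2,
      semiperimeter C.1 + 2 <= (2 * size C.2)%:Z & (size C.2 < r)%N].

Definition clustering (r : nat) (O : seq site) (P : seq cluster) : bool :=
  all (tight_cluster r) P && perm_eq (flatten [seq C.2 | C <- P]) O.

(** Diagonal contact counts: a site is activated by a horizontal and a vertical neighbour, and these
    two are diagonal to each other. *)
Definition touching (C D : cluster) : Prop := exists u v : site,
  [/\ in_rect C.1 u, in_rect D.1 v, `|u.1 - v.1| <= 1 & `|u.2 - v.2| <= 1].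

(** Contact costs at most one unit in each coordinate, so the semiperimeter of the hull exceeds the
    sum by at most 2, which the two terms [+ 2] pay for. Fewer than [2 * r] merged sites have a hull
    of semiperimeter below [4 * r], so sparsity forces their number below [r] again. *)
Lemma merge_clusters (r : nat) (O : seq site) (C D : cluster) (P : seq cluster) :
  uniq O -> sparse r O -> clustering r O [:: C, D & P] -> touching C D ->
  clustering r O ((rect_hull C.1 D.1, C.2 ++ D.2) :: P).
Proof.
case: C D => [[[[a b] c] d] A] [[[[a' b'] c'] d'] A'] uO spO.
rewrite /clustering /tight_cluster /=.
case/andP => /and3P[/and4P[A0 inA szA ltA] /and4P[A'0 inA' szA' ltA'] ->] pO.
move=> [[u1 u2] [[v1 v2] [/= inu inv d1 d2]]].
rewrite -catA pO andbT.
have inAA : all (in_rect (rect_hull (a, b, c, d) (a', b', c', d'))) (A ++ A').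
  rewrite all_cat; apply/andP; split; apply/allP => -[s1 s2] sA.
    by move: (allP inA _ sA) => /=; lia.
  by move: (allP inA' _ sA) => /=; lia.
have szAA : semiperimeter (rect_hull (a, b, c, d) (a', b', c', d')) + 2
    <= (2 * size (A ++ A'))%:Z.
  by rewrite size_cat /=; lia.
rewrite andbT; apply/and4P; split => //.
  by case: (A) A0.
rewrite ltnNge; apply/negP => big.
have uAA : uniq (A ++ A').
  by move: uO; rewrite -(perm_uniq pO) catA cat_uniq => /and3P[].
have sAA : {subset A ++ A' <= O}.
  by move=> s sAA; rewrite -(perm_mem pO) catA mem_cat sAA.
have := spO _ _ uAA sAA big inAA.
by rewrite /=; lia.
Qed.

(** Start from singletons and merge touching clusters; each merge lowers the number of clusters. *)
Lemma separated_clustering (r : nat) (O : seq site) :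
  (1 < r)%N -> uniq O -> sparse r O ->
  exists2 P, clustering r O P &
    forall C D, C \in P -> D \in P -> touching C D -> C = D.
Proof.
move=> r1 uO spO.
have start : clustering r O
    [seq ((s.1, s.1, s.2, s.2), [:: s]) : cluster | s : site <- O].
  apply/andP; split.
    by apply/allP => _ /mapP[[x y] _ ->]; rewrite /tight_cluster /= r1; lia.
  by rewrite -map_comp /comp /= flatten_seq1.
move: [seq _ | _ : site <- O] start => P clP.
move: {2}(size P) (leqnn (size P)) => n; elim: n P clP => [|n IH] P clP szP.
  by exists P => // C D; move: szP; rewrite leqn0 size_eq0 => /eqP->.
have [sep|] := pselect (forall C D, C \in P -> D \in P -> touching C D -> C = D).
  by exists P.
move=> /existsNP[C /existsNP[D]] /not_implyP[CP] /not_implyP[DP] /not_implyP[tCD CD].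
have DP' : D \in rem C P.
  move: DP; rewrite (perm_mem (perm_to_rem CP)) inE => /orP[/eqP DC|//].
  by case: CD.
have pP : perm_eq P [:: C, D & rem D (rem C P)].
  by rewrite (permPl (perm_to_rem CP)) perm_cons perm_to_rem.
apply: (IH ((rect_hull C.1 D.1, C.2 ++ D.2) :: rem D (rem C P))).
  apply: merge_clusters => //.
  case/andP: clP => tP pO; apply/andP; split.
    by rewrite -(perm_all _ pP).
  apply: perm_trans pO; apply: perm_flatten.
  by rewrite perm_sym; apply: perm_map.
by move: szP; rewrite (perm_size pP) /= ltnS.
Qed.

(** [K] is the union of the rectangles of a separated clustering. Two neighbours that would activate
    a site lie in touching rectangles, hence in a single one, which then contains the site. Each
    rectangle holds a site of [O] and has semiperimeter below [2 * r]. *)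
Lemma sparse_closure (r : nat) (O : seq site) :
  (1 < r)%N -> uniq O -> sparse r O ->
  exists K : set site, [/\ bootstrap_closed K, forall s, s \in O -> K s &
    forall x y, K (x, y) -> exists2 o : site, o \in O &
      `|o.1 - x| <= (2 * r)%:Z /\ `|o.2 - y| <= (2 * r)%:Z].
Proof.
move=> r1 uO spO; have [P /andP[tP pO] sep] := separated_clustering r1 uO spO.
exists [set s | exists2 C, C \in P & in_rect C.1 s]; split=> [x y Kh Kv|s sO|x y [C CP]].
- have [u [C CP inC] [u1 u2]] : exists2 u : site,
      exists2 C, C \in P & in_rect C.1 u & (`|u.1 - x| = 1 /\ u.2 = y).
    by case: Kh => -[C CP inC]; [exists (x - 1, y)|exists (x + 1, y)];
      try (exists C => //); move=> /=; split; lia.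
  have [v [D DP inD] [v1 v2]] : exists2 v : site,
      exists2 C, C \in P & in_rect C.1 v & (v.1 = x /\ `|v.2 - y| = 1).
    by case: Kv => -[D DP inD]; [exists (x, y - 1)|exists (x, y + 1)];
      try (exists D => //); move=> /=; split; lia.
  have CD : C = D by apply: sep => //; exists u, v; split => //; lia.
  exists C => //; move: inC inD; rewrite -CD.
  case: C {CP CD} => [[[[a b] c] d] A] /=; case: u u1 u2 => ? ?; case: v v1 v2 => ? ? /=.
  lia.
- move: sO; rewrite -(perm_mem pO) => /flattenP[A /mapP[C CP ->] sA].
  by exists C => //; have /and4P[_ /allP inC _ _] := allP tP _ CP; exact: inC.
- have /and4P[C0 /allP inC szC ltC] := allP tP _ CP.
  case: C CP C0 inC szC ltC => [[[[a b] c] d] A] /= CP A0 inC szC ltC inxy.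
  case: A A0 CP inC szC ltC => [//|o A] _ CP inC szC ltC; exists o.
    rewrite -(perm_mem pO); apply/flattenP; exists (o :: A); last exact: mem_head.
    by apply/mapP; eexists; first exact: CP.
  have := inC o (mem_head _ _).
  by move: inxy szC ltC => /=; lia.
Qed.

(** * Walls and chambers *)

Definition reflect (s : site) : site := (- s.1, s.2).

(* The row [r j] starts at the closed site [(B j, r j)]; the column [X j]
   joins the rows [r j] and [r j.+1]. *)
Record left_wall (k : nat) (W : int) (c : configuration) (J0 J1 : nat)
    (r B X : nat -> int) : Prop := LeftWall {
  lw_incr : forall j, (J0 <= j < J1)%N -> r j < r j.+1;
  lw_col : forall j, (J0 <= j < J1)%N -> [/\ B j <= X j, B j.+1 <= X j & X j < 0];
  lw_end : forall j, (J0 <= j <= J1)%N -> - W <= B j /\ c (B j, r j) = Closed;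
  lw_row : forall j x, (J0 <= j < J1)%N -> B j <= x <= X j -> c (x, r j) <> Occupied;
  lw_rowS : forall j x, (J0 <= j < J1)%N -> B j.+1 <= x <= X j ->
    c (x, r j.+1) <> Occupied;
  lw_thick : forall j x y, (J0 <= j < J1)%N -> `|x - X j| <= k.+1%:Z ->
    r j - k.+1%:Z <= y <= r j.+1 + k.+1%:Z -> c (x, y) <> Occupied
}.

Section Wall.
Variables (k : nat) (W : int) (c : configuration) (J0 J1 : nat).
Variables (r B X : nat -> int).
Hypothesis wall : left_wall k W c J0 J1 r B X.

(** The region on the wall and to its right: on a row it begins at the closed end, strictly between
    two rows at the column. *)
Definition wall_side : set site := [set s | exists j,
  ((J0 <= j <= J1)%N /\ s.2 = r j /\ B j <= s.1) \/
  ((J0 <= j < J1)%N /\ r j < s.2 < r j.+1 /\ X j <= s.1)].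

Definition wall_sites : set site := [set s | exists2 j, (J0 <= j < J1)%N &
  [\/ s.2 = r j /\ B j <= s.1 <= X j, s.2 = r j.+1 /\ B j.+1 <= s.1 <= X j |
      s.1 = X j /\ r j <= s.2 <= r j.+1]].

Lemma wall_row_le (i j : nat) : (J0 <= i)%N -> (i <= j)%N -> (j <= J1)%N -> r i <= r j.
Proof.
move=> Ji ij; elim: j ij => [|j IH] ij jJ.
  by have -> : i = 0%N by lia.
have [->//|ltij] := eqVneq i j.+1.
by have := IH ltac:(lia) ltac:(lia); have := lw_incr wall (j := j) ltac:(lia); lia.
Qed.

Lemma wall_row_lt (i j : nat) : (J0 <= i)%N -> (i < j)%N -> (j <= J1)%N -> r i < r j.
Proof.
move=> Ji ij jJ; have := lw_incr wall (j := i) ltac:(lia).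
by have := @wall_row_le i.+1 j ltac:(lia) ij jJ; lia.
Qed.

Lemma wall_locate (y : int) : (J0 <= J1)%N -> r J0 <= y <= r J1 -> exists j,
  ((J0 <= j <= J1)%N /\ y = r j) \/ ((J0 <= j < J1)%N /\ r j < y < r j.+1).
Proof.
move=> J01 /andP[y0].
suff loc j : (J0 <= j <= J1)%N -> y <= r j -> exists j,
    ((J0 <= j <= J1)%N /\ y = r j) \/ ((J0 <= j < J1)%N /\ r j < y < r j.+1).
  by apply: loc; lia.
elim: j => [|j IH] jJ yj.
  have J00 : J0 = 0%N by lia.
  by exists 0%N; left; split => //; move: y0; rewrite J00; lia.
have [yr|ry] := lerP y (r j).
  have [Jj|Jj] := leqP J0 j; first by apply: IH => //; lia.
  have E : J0 = j.+1 by lia.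
  by exists j.+1; left; split => //; rewrite -E in yj *; lia.
have [Jj|Jj] := leqP J0 j; last first.
  have E : J0 = j.+1 by lia.
  by exists j.+1; left; split => //; rewrite -E in yj *; lia.
have [->|yn] := eqVneq y (r j.+1); first by exists j.+1; left; split => //; lia.
by exists j; right; split; lia.
Qed.

Lemma wall_side_right (x y : int) : (J0 <= J1)%N -> 0 <= x -> r J0 <= y <= r J1 ->
  (J0 < J1)%N -> wall_side (x, y).
Proof.
move=> J01 x0 yr ltJ; have [j [[jJ yj]|[jJ yj]]] := wall_locate J01 yr; exists j.
  left; split => //; split => //=.
  have [ltj|gej] := ltnP j J1.
    by have [] := lw_col wall (j := j) ltac:(lia); lia.
  by have [] := lw_col wall (j := j.-1) ltac:(lia); rewrite prednK; lia.
by right; split => //; split => //=; have [] := lw_col wall (j := j) jJ; lia.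
Qed.

(** Off the wall, a site on an inner row lies beyond both adjacent columns, and a site between two
    rows beyond the column joining them; both rows joined by a column start at or before it. *)
Lemma wall_side_neighbors (x y : int) : wall_side (x, y) -> ~ wall_sites (x, y) ->
  r J0 < y < r J1 ->
  [/\ wall_side (x - 1, y), wall_side (x + 1, y), wall_side (x, y - 1) &
      wall_side (x, y + 1)].
Proof.
move=> [j [[jJ [/= yj xB]]|[jJ [/= yj xX]]]] nS yJ.
  have J0j : (J0 < j)%N.
    by rewrite ltn_neqAle; apply/andP; split; [apply/eqP => E; move: yJ; rewrite E|]; lia.
  have jJ1 : (j < J1)%N.
    by rewrite ltn_neqAle; apply/andP; split; [apply/eqP => E; move: yJ; rewrite -E|]; lia.
  have xX : X j < x.
    by rewrite ltNge; apply/negP => xX; apply: nS; exists j; [lia|constructor 1; split => //=; lia].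
  have xX' : X j.-1 < x.
    rewrite ltNge; apply/negP => xX'; apply: nS; exists j.-1; first lia.
    by constructor 2; rewrite prednK; last lia; split => //=; lia.
  have [B1 B2 _] := lw_col wall (j := j) ltac:(lia).
  have [B3 B4 _] := lw_col wall (j := j.-1) ltac:(lia).
  have r1 := lw_incr wall (j := j) ltac:(lia).
  have := lw_incr wall (j := j.-1) ltac:(lia); rewrite prednK; last lia; move=> r2.
  split; [exists j; left; split => //=; lia..| |].
    have [E|E] := eqVneq (y - 1) (r j.-1).
      by exists j.-1; left; split => /=; lia.
    by exists j.-1; right; rewrite prednK; last lia; split => /=; lia.
  have [E|E] := eqVneq (y + 1) (r j.+1).
    by exists j.+1; left; split => /=; lia.
  by exists j; right; split => /=; lia.
have xnX : x <> X j.
  by move=> E; apply: nS; exists j => //; constructor 3 => /=; lia.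
have [B1 B2 _] := lw_col wall jJ.
split; [exists j; right; split => //=; lia..| |].
  have [E|E] := eqVneq (y - 1) (r j); first by exists j; left; split => /=; lia.
  by exists j; right; split => //=; lia.
have [E|E] := eqVneq (y + 1) (r j.+1); first by exists j.+1; left; split => /=; lia.
by exists j; right; split => //=; lia.
Qed.

Lemma wall_sites_unoccupied (s : site) : wall_sites s -> c s <> Occupied.
Proof.
case: s => x y [j jJ [[/= -> xB]|[/= -> xB]|[/= -> yr]]].
- exact: (lw_row wall jJ).
- exact: (lw_rowS wall jJ).
- by apply: (lw_thick wall jJ); lia.
Qed.

(* The right end of a row is the only place where a wall relies on the region
   to its right: thickness of the columns keeps [K] away from there. *)
Lemma wall_sites_stable (K V : set site) (x y : int) :
  (forall x y, K (x, y) -> exists2 o : site, c o = Occupied &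
     `|o.1 - x| <= k%:Z /\ `|o.2 - y| <= k%:Z) ->
  wall_sites `<=` V ->
  (forall x y, x <= 0 -> wall_side (x, y) -> r J0 < y < r J1 -> ~ K (x, y) -> V (x, y)) ->
  wall_sites (x, y) -> r J0 < y < r J1 ->
  [\/ c (x, y) = Closed, V (x - 1, y) /\ V (x + 1, y) |
      V (x, y - 1) /\ V (x, y + 1)].
Proof.
move=> Kocc SV sideV Sxy yJ.
have row j : (J0 < j < J1)%N -> y = r j -> B j <= x ->
    (x <= X j) || (x <= X j.-1) ->
    c (x, y) = Closed \/ V (x - 1, y) /\ V (x + 1, y).
  move=> jJ yj xB xX.
  have S1 x' : B j <= x' <= X j -> V (x', y).
    by move=> xx; apply: SV; exists j; [lia|constructor 1 => /=; lia].
  have S2 x' : B j <= x' <= X j.-1 -> V (x', y).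
    move=> xx; apply: SV; exists j.-1; first by lia.
    by constructor 2; rewrite prednK; [split => //=; lia|lia].
  have [xE|xE] := eqVneq x (B j).
    by left; rewrite xE yj; apply: (lw_end wall _).2; lia.
  right; split.
    by case/orP: xX => xX; [apply: S1|apply: S2]; lia.
  have [_ _ X1] := lw_col wall (j := j) ltac:(lia).
  have [_ _ X2] := lw_col wall (j := j.-1) ltac:(lia).
  have [l1|g1] := ltrP x (X j); first by apply: S1; lia.
  have [l2|g2] := ltrP x (X j.-1); first by apply: S2; lia.
  (* Here [x] is the abscissa of one of the two columns; the [+ 1] in the thickness [k.+1] pays for
     testing [x + 1] against [K]. *)
  apply: sideV => //; first by case/orP: xX; lia.
    by exists j; left; split => /=; lia.
  move=> /Kocc[[z1 z2] zO [/= d1 d2]].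
  have r1 := lw_incr wall (j := j) ltac:(lia).
  have := lw_incr wall (j := j.-1) ltac:(lia); rewrite prednK; last lia; move=> r2.
  case/orP: xX => xX.
    by apply: (lw_thick wall (j := j) _ _ _ zO); lia.
  by apply: (lw_thick wall (j := j.-1) _ _ _ zO); rewrite ?prednK; lia.
have notJ0 j : y = r j -> j <> J0 by move=> yj E; move: yJ; rewrite yj E; lia.
have notJ1 j : y = r j -> j <> J1 by move=> yj E; move: yJ; rewrite yj E; lia.
case: Sxy => j jJ [[/= yj xB]|[/= yj xB]|[/= xX yr]].
- have jJ0 := notJ0 _ yj.
  by have [] := row j ltac:(lia) yj ltac:(lia) ltac:(lia); [constructor 1|constructor 2].
- have jJ1 := notJ1 _ yj.
  by have [] := row j.+1 ltac:(lia) yj ltac:(lia) ltac:(rewrite /=; lia);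
    [constructor 1|constructor 2].
- have [B1 B2 _] := lw_col wall jJ.
  have [yj|yj] := eqVneq y (r j).
    have jJ0 := notJ0 _ yj.
    by have [] := row j ltac:(lia) yj ltac:(lia) ltac:(lia); [constructor 1|constructor 2].
  have [yj'|yj'] := eqVneq y (r j.+1).
    have jJ1 := notJ1 _ yj'.
    by have [] := row j.+1 ltac:(lia) yj' ltac:(lia) ltac:(rewrite /=; lia);
      [constructor 1|constructor 2].
  by constructor 3; split; apply: SV; exists j => //; constructor 3; split => //=; lia.
Qed.

Lemma wall_side_bound (x y : int) : wall_side (x, y) -> - W <= x /\ r J0 <= y <= r J1.
Proof.
move=> [j [[jJ [/= -> xB]]|[jJ [/= yj xX]]]].
  have [] := lw_end wall jJ; have := @wall_row_le J0 j; have := @wall_row_le j J1; lia.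
have [] := lw_col wall jJ; have [] := lw_end wall (j := j) ltac:(lia).
have := @wall_row_le J0 j; have := @wall_row_le j.+1 J1; lia.
Qed.

Lemma wall_sites_bound (x y : int) : wall_sites (x, y) ->
  [/\ - W <= x, x < 0 & r J0 <= y <= r J1].
Proof.
move=> [j jJ H]; have [b1 b2 b3] := lw_col wall jJ; have [] := lw_end wall (j := j) ltac:(lia).
have [] := lw_end wall (j := j.+1) ltac:(lia).
have := @wall_row_le J0 j; have := @wall_row_le j.+1 J1; have := lw_incr wall jJ.
by case: H => /= -[]; move=> *; split; lia.
Qed.
End Wall.

(* The chamber between a left wall, the mirror image of another one and two lids,
   minus the internal growth [K], together with the walls and the lids. *)
Section Chamber.
Variables (k : nat) (W : int) (c : configuration) (J0 J1 : nat).
Variables (r B X r' B' X' : nat -> int) (bot top : int) (K : set site).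
Hypothesis left : left_wall k W c J0 J1 r B X.
Hypothesis right : left_wall k W (c \o reflect) J0 J1 r' B' X'.
Hypothesis ltJ : (J0 < J1)%N.
Hypothesis ends : [/\ r J0 = bot, r' J0 = bot, r J1 = top & r' J1 = top].
Hypothesis lids : forall y : int, y = bot \/ y = top ->
  [/\ c (- W, y) = Closed, c (W, y) = Closed &
      forall x : int, - W <= x <= W -> c (x, y) <> Occupied].
Hypothesis closedK : bootstrap_closed K.
Hypothesis occK : forall x y : int, - W <= x <= W -> bot <= y <= top ->
  c (x, y) = Occupied -> K (x, y).
Hypothesis nearK : forall x y, K (x, y) -> exists2 z : site, c z = Occupied &
  `|z.1 - x| <= k%:Z /\ `|z.2 - y| <= k%:Z.

Let inside := [set s | [/\ wall_side J0 J1 r B X s,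
  wall_side J0 J1 r' B' X' (reflect s), bot < s.2 < top & ~ K s]].
Let lid := [set s : site | - W <= s.1 <= W /\ (s.2 = bot \/ s.2 = top)].
Let V := [set s | [\/ inside s, lid s, wall_sites J0 J1 r B X s |
  wall_sites J0 J1 r' B' X' (reflect s)]].

Lemma chamber_bound (x y : int) : V (x, y) -> - W <= x <= W /\ bot <= y <= top.
Proof.
have [E1 E2 E3 E4] := ends.
have bt := wall_row_lt left (leqnn _) ltJ (leqnn _); rewrite E1 E3 in bt.
move=> [[/(wall_side_bound left)[b1 b2] /(wall_side_bound right)[b3 b4] /= b5 _]|
  [/= b1 b2]|/(wall_sites_bound left)[b1 b2 b3]|/(wall_sites_bound right)[b1 b2 b3]].
- by move: b3 => /=; lia.
- by move: b2; lia.
- by rewrite E1 E3 in b3; lia.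
- by rewrite E2 E4 /= in b3; move: b1 b2 => /=; lia.
Qed.

(** Lid sites rely on their row and its closed ends, wall sites on [wall_sites_stable], after
    reflection for the right wall. For an interior site off [K], bootstrap closedness of [K] leaves
    a direction in which both neighbours avoid [K], and these are still on the inner side of both
    walls. *)
Lemma stable_chamber : stable_set c V.
Proof.
have [E1 E2 E3 E4] := ends; have leJ := ltnW ltJ.
have bt := wall_row_lt left (leqnn _) ltJ (leqnn _); rewrite E1 E3 in bt.
have lidV (x y : int) : y = bot \/ y = top -> - W <= x <= W -> V (x, y).
  by move=> yl xW; constructor 2.
move=> x y Vxy; have [bx byy] := chamber_bound Vxy.
have [yl|ynl] := pselect (y = bot \/ y = top).
  have [cl cr co] := lids yl; split; first exact: co.
  have [->|xn] := eqVneq x (- W); first by constructor 1.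
  have [->|xn'] := eqVneq x W; first by constructor 1.
  by constructor 2; split; apply: lidV => //; lia.
have yJ : bot < y < top by lia.
split.
  case: Vxy => [[_ _ _ nK] cO|[_ //]|/(wall_sites_unoccupied left)//|
    /(wall_sites_unoccupied right)/=].
    by apply: nK; exact: occK.
  by rewrite /reflect /= opprK.
have [SL|nSL] := pselect (wall_sites J0 J1 r B X (x, y)).
  (* Sites with [u <= 0] are on the inner side of the mirrored wall, whose columns are negative
     before reflection. *)
  apply: (wall_sites_stable left nearK) SL _ => [s Ss|u v u0 side yv nK|]; last by rewrite E1 E3.
    by constructor 3.
  constructor 1; split => //=; last by rewrite -E1 -E3.
  by apply: (wall_side_right right) => //=; [lia|rewrite E2 E4; rewrite E1 E3 in yv; lia].
have [SR|nSR] := pselect (wall_sites J0 J1 r' B' X' (reflect (x, y))).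
  have reflectD (u v : int) :
      reflect (u - 1, v) = (- u + 1, v) /\ reflect (u + 1, v) = (- u - 1, v).
    by rewrite /reflect /=; split; congr pair; lia.
  have := wall_sites_stable right (K := K \o reflect) (V := V \o reflect) _ _ _ SR.
  rewrite /= !(reflectD _ _).1 !(reflectD _ _).2 !opprK E2 E4 => H.
  case: H => //.
  - move=> u v /nearK[[z1 z2] zO [/= d1 d2]]; exists (- z1, z2) => /=.
      by rewrite /reflect /= opprK.
    by lia.
  - by move=> [u v] S; constructor 4; rewrite /reflect /= opprK.
  - move=> u v u0 side yv nK; constructor 1; split => //=; last by rewrite /reflect /= opprK.
    have u0' : 0 <= - u by lia.
    by apply: (wall_side_right left) => //; rewrite E1 E3 /=; lia.
  - by rewrite /reflect /= opprK; constructor 1.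
  - by case=> ? ?; constructor 2.
  - by rewrite /reflect /= opprK; constructor 3.
case: Vxy => [[sL sR _ nK]|[_ //]|//|//].
have [l1 l2 l3 l4] := wall_side_neighbors left sL nSL ltac:(rewrite E1 E3 /=; lia).
have [r1 r2 r3 r4] := wall_side_neighbors right sR nSR ltac:(rewrite E2 E4 /=; lia).
have inV u v : wall_side J0 J1 r B X (u, v) -> wall_side J0 J1 r' B' X' (- u, v) ->
    ~ K (u, v) -> V (u, v).
  move=> sl sr nKuv; have [ul|unl] := pselect (v = bot \/ v = top).
    have [? ?] := wall_side_bound left sl; have [? ?] := wall_side_bound right sr.
    by apply: lidV => //; lia.
  have [_] := wall_side_bound left sl; rewrite E1 E3 => vb.
  by constructor 1; split => //=; lia.
have [Kh|nKh] := pselect (K (x - 1, y) \/ K (x + 1, y)).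
  have nKv : ~ (K (x, y - 1) \/ K (x, y + 1)) by move=> Kv; apply: nK; exact: closedK.
  by constructor 3; split; apply: inV => // ?; apply: nKv; [left|right].
constructor 2; split; apply: inV => //.
- by move: r2; rewrite opprB addrC.
- by move=> ?; apply: nKh; left.
- by move: r1; rewrite opprD.
- by move=> ?; apply: nKh; right.
Qed.

Lemma chamber_origin : bot < 0 < top -> ~ K origin -> V origin.
Proof.
have [E1 E2 E3 E4] := ends; have leJ := ltnW ltJ.
move=> yJ nK; constructor 1; split => //=.
  by apply: (wall_side_right left) => //; rewrite E1 E3 /=; lia.
by rewrite /reflect /= oppr0; apply: (wall_side_right right) => //; rewrite E2 E4 /=; lia.
Qed.
End Chamber.

(** * Lipschitz percolation *)

Section LipschitzPercolation.
Variables (M n : nat) (bad : nat -> nat -> bool).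
Local Open Scope nat_scope.

(* A node [(i, j)] is reached when every Lipschitz function avoiding the bad
   nodes must be at least [i] at [j]: it costs a bad node to move up, while
   moving down diagonally is free. *)
Definition climb (u v : nat * nat) : bool :=
  [&& v.1 == u.1.+1, v.2 == u.2, u.1 < M & bad u.1 u.2] ||
  [&& u.1 == v.1.+1, (v.2 == u.2.+1) || (u.2 == v.2.+1) & v.2 < n].

(** The nodes from which the path moves up: on a [climb] path these are the bad nodes it pays
    for. *)
Fixpoint ascents (u : nat * nat) (p : seq (nat * nat)) : seq (nat * nat) :=
  if p is v :: p' then
    if v.1 == u.1.+1 then u :: ascents v p' else ascents v p'
  else [::].

(** A superset of the [climb] paths of length [m] that is easy to count; at height or abscissa 0 the
    truncated [.-1] only adds spurious walks. *)
Fixpoint walks (m : nat) (u : nat * nat) : seq (seq (nat * nat)) :=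
  if m is m'.+1 then
    [seq v :: p | v <- [:: (u.1.+1, u.2); (u.1.-1, u.2.+1); (u.1.-1, u.2.-1)],
                  p <- walks m' v]
  else [:: [::]].

Lemma size_walks m u : size (walks m u) = 3 ^ m.
Proof.
elim: m u => [//|m IH] u.
rewrite [LHS]size_allpairs_dep /= !IH expnS; lia.
Qed.

Lemma climb_walk u p : path climb u p -> p \in walks (size p) u.
Proof.
elim: p u => [//|[i j] p IH] [i' j']; rewrite [path _ _ _]/= => /andP[uv /IH pw].
apply/allpairsPdep; exists (i, j), p; split => //.
case/orP: uv => /= [/and4P[/eqP-> /eqP-> _ _]|/and3P[/eqP-> /orP[/eqP->|/eqP->] _]];
  by rewrite !inE eqxx ?orbT.
Qed.

(** Every move changes the height by one, so ascents minus descents is the gain in height. Being a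
    subsequence of the path, the ascents are distinct when the path is self-avoiding. *)
Lemma climb_ascents u p : path climb u p -> u.2 < n ->
  [/\ all (fun v => [&& v.1 < M, v.2 < n & bad v.1 v.2]) (ascents u p),
      2 * size (ascents u p) + u.1 = size p + (last u p).1 &
      subseq (ascents u p) (belast u p)].
Proof.
elim: p u => [//|v p IH] u /= /andP[uv pp] un.
have vn : v.2 < n.
  by case/orP: uv => [/and4P[_ /eqP-> _ _]|/and3P[_ _ ->]].
have [IH1 IH2 IH3] := IH _ pp vn.
case/orP: uv => [/and4P[/eqP vu /eqP vu2 uM bu]|/and3P[/eqP vu _ _]].
  by rewrite vu eqxx /= uM un bu eqxx; split => //; lia.
have -> : (v.1 == u.1.+1) = false by lia.
split => //; first by lia.
by apply: subseq_trans IH3 (subseq_cons _ _).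
Qed.

Lemma climb_grid u p : path climb u p -> u.1 <= M -> u.2 < n ->
  all (fun v => (v.1 < M.+1) && (v.2 < n)) (u :: p).
Proof.
elim: p u => [|v p IH] u; first by rewrite /= ltnS => _ -> ->.
rewrite [path _ _ _]/= => /andP[uv pp] uM un.
have : v.1 <= M /\ v.2 < n.
  case/orP: uv => [/and4P[/eqP-> /eqP-> ? _]|/and3P[/eqP E _ ->]]; split; lia.
by case=> vM vn; have := IH _ pp vM vn; rewrite /= => ->; rewrite ltnS uM un.
Qed.

(** Let [F j] be the greatest height reached in column [j]. That node is not bad, or the path could
    move up; and the free diagonal descents make [F] Lipschitz. *)
Lemma lipschitz_avoiding :
  (forall j p, j < n -> path climb (0, j) p -> (last (0, j) p).1 < M) ->
  exists F : nat -> nat,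
    [/\ forall j, j < n -> F j < M /\ ~~ bad (F j) j &
        forall j, j.+1 < n -> F j <= (F j.+1).+1 /\ F j.+1 <= (F j).+1].
Proof.
move=> nocross.
pose reach u := exists2 j, j < n &
  exists2 p, path climb (0, j) p & last (0, j) p = u.
have reachS u v : reach u -> climb u v -> reach v.
  move=> [j jn [p pp pu]] uv; exists j => //; exists (rcons p v).
    by rewrite rcons_path pp pu.
  by rewrite last_rcons.
have reachM u : reach u -> u.1 < M by case=> j jn [p pp <-]; exact: nocross.
have /choice[F FP] : forall j, exists i, j < n ->
    reach (i, j) /\ forall i', reach (i', j) -> i' <= i.
  move=> j; have [jn|jn] := ltnP j n; last by exists 0.
  have ex : exists i, `[< reach (i, j) >].
    by exists 0; apply/asboolP; exists j => //; exists [::].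
  have bd i : `[< reach (i, j) >] -> i <= M by move=> /asboolP/reachM/ltnW.
  exists (ex_maxn ex bd) => _; case: ex_maxnP => i /asboolP ri mi; split => // i' ri'.
  by apply: mi; exact/asboolP.
exists F; split => j jn.
  have [rF mF] := FP _ jn; have FM := reachM _ rF; split => //.
  apply/negP => bF; suff /mF : reach ((F j).+1, j) by rewrite ltnn.
  by apply: reachS rF _; rewrite /climb /= !eqxx FM bF.
have jn' := ltnW jn; have [r1 m1] := FP _ jn'; have [r2 m2] := FP _ jn.
split; rewrite -ltnS ltnNge; apply/negP => lt.
  case E : (F j) lt r1 => [//|f] lt r1; suff /m2 : reach (f, j.+1) by lia.
  by apply: reachS r1 _; rewrite /climb /= !eqxx jn orbT.
case E : (F j.+1) lt r2 => [//|f] lt r2; suff /m1 : reach (f, j) by lia.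
by apply: reachS r2 _; rewrite /climb /= !eqxx jn' !orbT.
Qed.

Lemma blocking_walk :
  ~ (exists F : nat -> nat,
    [/\ forall j, j < n -> F j < M /\ ~~ bad (F j) j &
        forall j, j.+1 < n -> F j <= (F j.+1).+1 /\ F j.+1 <= (F j).+1]) ->
  exists2 j, j < n & exists2 m, m < M.+1 * n & exists2 p, p \in walks m (0, j) &
    [/\ uniq (ascents (0, j) p), 2 * size (ascents (0, j) p) = m + M &
        all (fun v => [&& v.1 < M, v.2 < n & bad v.1 v.2]) (ascents (0, j) p)].
Proof.
move=> noF; apply: contrapT => nowalk; apply: noF; apply: lipschitz_avoiding.
move=> j p jn pp; rewrite ltnNge; apply/negP => Mp.
apply: nowalk; exists j => //.
(* A self-avoiding crossing has distinct ascents, and its length is bounded by the number [M.+1 * n]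
   of grid nodes. *)
move: Mp; case/shortenP: pp => {p}p pp up _ Mp.
have grid := climb_grid pp (leq0n _) jn.
have lastM : (last (0, j) p).1 = M.
  apply/eqP; rewrite eqn_leq Mp andbT.
  by have /andP[] := allP grid _ (mem_last _ _).
have [a1 a2 a3] := climb_ascents pp jn.
exists (size p).
  have : {subset (0, j) :: p <= [seq (x, y) | x <- iota 0 M.+1, y <- iota 0 n]}.
    move=> [x y] /(allP grid)/andP[xM yn].
    by apply/allpairsP; exists (x, y); rewrite !mem_iota.
  by move=> /(uniq_leq_size up); rewrite size_allpairs !size_iota.
exists p; first exact: climb_walk.
split => //; last by move: a2; rewrite lastM /=; lia.
apply: subseq_uniq a3 _.
by move: up; rewrite lastI rcons_uniq => /andP[].
Qed.
End LipschitzPercolation.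

(** * Product measures on finite boxes *)

Definition state_code (s : state) : 'I_3 :=
  match s with Occupied => inord 0 | Closed => inord 1 | Open => inord 2 end.

Definition state_decode (i : 'I_3) : state :=
  match val i with 0%N => Occupied | 1%N => Closed | _ => Open end.

Lemma state_codeK : cancel state_code state_decode.
Proof. by case; rewrite /state_decode /state_code /= inordK. Qed.

HB.instance Definition _ : isCountable state := CanIsCountable state_codeK.
HB.instance Definition _ : fintype.isFinite state := CanIsFinite state_codeK.

Lemma big_state (V : nmodType) (F : state -> V) :
  \sum_(s : state) F s = F Occupied + F Closed + F Open.
Proof.
rewrite (bigD1 Occupied) //= (bigD1 Closed) /=; last exact/eqP.
rewrite (bigD1 Open) /=; last by apply/andP; split; exact/eqP.
rewrite big_pred0 ?addr0 ?addrA //; case; rewrite ?eqxx ?andbF //=.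
Qed.

Definition determined (D : set site) (A : configuration -> Prop) : Prop :=
  forall c c', (forall x, D x -> c x = c' x) -> A c -> A c'.

Section FiniteModel.
Variables (R : realType) (mu : state -> R) (Box : {fset site}).
Hypothesis mu_ge0 : forall s, 0 <= mu s.
Hypothesis mu_sum : mu Occupied + mu Closed + mu Open = 1.

(** Sites outside [Box] read as [Open], so a single site has law [mu] only within [Box]. *)
Definition extend (c : {ffun Box -> state}) : configuration :=
  fun x => if insub x is Some t then c t else Open.

Definition weight (c : {ffun Box -> state}) : R := \prod_t mu (c t).

Definition Pr (A : configuration -> Prop) : R :=
  \sum_(c | `[< A (extend c) >]) weight c.

Lemma extend_val (c : {ffun Box -> state}) (t : Box) : extend c (val t) = c t.
Proof. by rewrite /extend valK. Qed.

Lemma weight_ge0 c : 0 <= weight c.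
Proof. exact: prodr_ge0. Qed.

Lemma Pr_ge0 A : 0 <= Pr A.
Proof. by apply: sumr_ge0 => c _; exact: weight_ge0. Qed.

Lemma Pr_mono (A B : configuration -> Prop) : (forall c, A c -> B c) -> Pr A <= Pr B.
Proof.
move=> AB; rewrite /Pr [leLHS]big_mkcond [leRHS]big_mkcond; apply: ler_sum => c _.
case: asboolP => [/AB Bc|_]; first by case: asboolP.
by case: asboolP => // _; exact: weight_ge0.
Qed.

Lemma Pr_ext (A B : configuration -> Prop) : (forall c, A c <-> B c) -> Pr A = Pr B.
Proof. by move=> AB; apply/eqP; rewrite eq_le !Pr_mono // => c /AB. Qed.

Lemma Pr_site (x : site) (B : set state) : x \in Box ->
  Pr (fun c => B (c x)) = \sum_(s | `[< B s >]) mu s.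
Proof.
move=> xB; pose t : Box := [` xB]%fset.
(* The event is a product set constrained only at [t]; in the distributed product every other factor
   sums to 1. *)
pose Q (u : Box) (s : state) := (u == t) ==> `[< B s >].
transitivity (\prod_(u : Box) \sum_(s | Q u s) mu s).
  rewrite bigA_distr_big_dep /Pr; apply: eq_bigl => c.
  rewrite -[x]/(val t) extend_val; apply/idP/familyP => [Bc u|/(_ t)].
    by rewrite unfold_in /Q; case: eqP => [->|].
  by rewrite unfold_in /Q eqxx.
rewrite (bigD1 t) //= [X in _ * X]big1 ?mulr1 => [|u ut].
  by apply: eq_bigl => s; rewrite /Q eqxx.
by rewrite (eq_bigl xpredT) ?big_state // => s; rewrite /Q (negPf ut).
Qed.

Lemma Pr_true : Pr (fun=> True) = 1.
Proof.
rewrite /Pr (eq_bigl xpredT) => [|c]; last exact/asboolP.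
rewrite /weight -(bigA_distr_bigA (fun _ => mu)) big1 // => t _.
by rewrite big_state.
Qed.

Lemma Pr_split (A B : configuration -> Prop) :
  Pr A = Pr (fun c => A c /\ B c) + Pr (fun c => A c /\ ~ B c).
Proof.
rewrite /Pr (bigID (fun c => `[< B (extend c) >])) /=; congr (_ + _);
  by apply: eq_bigl => c; rewrite ?asbool_and // asbool_neg.
Qed.

Lemma Pr_not A : Pr (fun c => ~ A c) = 1 - Pr A.
Proof.
rewrite -Pr_true (Pr_split (fun=> True) A).
have -> : Pr (fun c => True /\ A c) = Pr A by apply: Pr_ext => c; tauto.
have -> : Pr (fun c => True /\ ~ A c) = Pr (fun c => ~ A c).
  by apply: Pr_ext => c; tauto.
by rewrite addrAC subrr add0r.
Qed.

Lemma Pr_or (A B : configuration -> Prop) :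
  Pr (fun c => A c \/ B c) <= Pr A + Pr B.
Proof.
rewrite (Pr_split _ A) lerD //; apply: Pr_mono; tauto.
Qed.

Lemma Pr_exists (I : eqType) (s : seq I) (A : I -> configuration -> Prop) :
  Pr (fun c => exists2 i, i \in s & A i c) <= \sum_(i <- s) Pr (A i).
Proof.
elim: s => [|i s IH].
  rewrite big_nil (Pr_ext (B := fun=> ~ True)) ?Pr_not ?Pr_true ?subrr // => c.
  by split => // -[].
rewrite big_cons; apply: le_trans (lerD (lexx _) IH); apply: le_trans (Pr_or _ _).
apply: Pr_mono => c [j]; rewrite inE => /orP[/eqP->|js] Aj; [by left|right].
by exists j.
Qed.

(* Exchanging two independent copies of the configuration outside [D]
   preserves the product weight. *)
Lemma Pr_and (D : set site) (A B : configuration -> Prop) :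
  determined D A -> determined (~` D) B ->
  Pr (fun c => A c /\ B c) = Pr A * Pr B.
Proof.
move=> dA dB.
pose mix (c c' : {ffun Box -> state}) : {ffun Box -> state} :=
  [ffun t => if `[< D (val t) >] then c t else c' t].
have mixD c c' x : D x -> extend (mix c c') x = extend c x.
  move=> Dx; rewrite /extend; case: insubP => // t _ tx.
  by rewrite ffunE tx; case: asboolP.
have mixN c c' x : ~ D x -> extend (mix c c') x = extend c' x.
  move=> Dx; rewrite /extend; case: insubP => // t _ tx.
  by rewrite ffunE tx; case: asboolP.
pose h (u : {ffun Box -> state} * {ffun Box -> state}) := (mix u.1 u.2, mix u.2 u.1).
have hK : involutive h.
  move=> [c c']; rewrite /h /=; congr pair; apply/ffunP => t; rewrite !ffunE;
  by case: asboolP.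
rewrite -[LHS]mulr1 -Pr_true /Pr !big_distrlr /= !pair_big /=.
rewrite [RHS](reindex_inj (inv_inj hK)) /=; apply: eq_big => [[c c']|[c c'] _] /=.
  apply/andP/andP => -[/asboolP A1 /asboolP A2]; split; apply/asboolP => //.
  - by case: A1 => Ac _; apply: dA Ac => x /mixD ->.
  - by case: A1 => _ Bc; apply: dB Bc => x /mixN ->.
  - by split; [apply: dA A1 => x /mixD ->|apply: dB A2 => x /mixN ->].
rewrite /weight -!big_split /=; apply: eq_bigr => t _; rewrite !ffunE.
by case: asboolP => // _; exact: mulrC.
Qed.

Lemma Pr_forall (I : eqType) (s : seq I) (D : I -> set site)
    (A : I -> configuration -> Prop) :
  uniq s -> (forall i, i \in s -> determined (D i) (A i)) ->
  (forall i j x, i \in s -> j \in s -> D i x -> D j x -> i = j) ->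
  Pr (fun c => forall i, i \in s -> A i c) = \prod_(i <- s) Pr (A i).
Proof.
elim: s => [|i s IH] /= => [_ _ _|/andP[is_ us] dA disj].
  by rewrite big_nil -Pr_true; apply: Pr_ext.
rewrite big_cons -IH // => [|j js|j k x js ks]; last 2 first.
- by apply: dA; rewrite inE js orbT.
- by apply: disj; rewrite inE ?js ?ks orbT.
rewrite -(Pr_and (D := D i)).
- apply: Pr_ext => c; split => [H|[Hi H] j].
    by split => [|j js]; apply: H; rewrite inE ?eqxx ?js ?orbT.
  by rewrite inE => /orP[/eqP->|/H].
- by apply: dA; rewrite mem_head.
- move=> c c' cc' H j js; apply: (dA j) (H j js) => [|x Dx].
    by rewrite inE js orbT.
  apply: cc' => Dix; move: is_; rewrite (disj i j x) ?js //.
    exact: mem_head.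
  by rewrite inE js orbT.
Qed.

Lemma Pr_sites (s : seq site) (B : site -> set state) :
  uniq s -> {subset s <= Box} ->
  Pr (fun c => forall x, x \in s -> B x (c x)) =
  \prod_(x <- s) \sum_(t | `[< B x t >]) mu t.
Proof.
move=> us sB; rewrite (Pr_forall (D := fun x => [set x])) //.
- by rewrite big_seq [RHS]big_seq; apply: eq_bigr => x /sB xB; exact: Pr_site.
- by move=> x _ c c' cc'; rewrite cc'.
- by move=> x y z _ _ /= -> ->.
Qed.

(** Relabelling the sites permutes the factors of each weight. With [reflect], the estimate for the
    left wall also serves the right one. *)
Lemma Pr_involution (tau : site -> site) (A : configuration -> Prop) :
  involutive tau -> (forall x, x \in Box -> tau x \in Box) ->
  Pr (fun c => A (c \o tau)) = Pr A.
Proof.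
move=> tauK tauB.
pose tB (t : Box) : Box := [` tauB _ (valP t)]%fset.
have tBK : involutive tB by move=> t; apply: val_inj; rewrite /= tauK.
pose h (c : {ffun Box -> state}) : {ffun Box -> state} := [ffun t => c (tB t)].
have hK : involutive h by move=> c; apply/ffunP => t; rewrite !ffunE tBK.
have exth c : extend (h c) = extend c \o tau.
  apply/funext => x /=; have [xB|xB] := boolP (x \in Box).
    rewrite -[x in LHS]/(val [` xB]%fset) extend_val ffunE.
    by rewrite -[tau x]/(val (tB [` xB]%fset)) extend_val.
  rewrite /extend !insubF //; apply/negbTE => //.
  by apply: contra xB => /tauB; rewrite tauK.
rewrite /Pr [RHS](reindex_inj (inv_inj hK)) /=; apply: eq_big => c.
  by rewrite exth.
move=> _; rewrite /weight [LHS](reindex_inj (inv_inj tBK)).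
by apply: eq_bigr => t _; rewrite ffunE.
Qed.
End FiniteModel.

Definition site_law (R : realType) (p q : R) (s : state) : R :=
  match s with Occupied => p | Closed => q | Open => 1 - p - q end.

(** * Comparison of an arbitrary probability space with the finite model *)

Section Transfer.
Variables (R : realType) (p q : R) (d : measure_display).
Variables (Omega : measurableType d) (P : probability Omega R).
Variables (X : site -> {RV P >-> state}) (Box : {fset site}).
Hypothesis law : polluted_initial_law p q X.

Let cylinder (c : {ffun Box -> state}) : set Omega :=
  \bigcap_(x in [set` Box]) (X x @^-1` [set extend c x]).

Let measurable_cylinder c : measurable (cylinder c).
Proof.
apply: fin_bigcap_measurable => [|x _]; first exact: finite_fset.
by rewrite -[X in measurable X]setTI; exact: measurable_funPT.
Qed.

Let prob_cylinder c : P (cylinder c) = (weight (site_law p q) c)%:E.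
Proof.
have [indep single] := law.
rewrite /cylinder (indep Box (fun x => [set extend c x])) //.
rewrite big_seq_fsetE /weight -prodEFin; apply: eq_bigr => t _ /=.
have [pO pC pop] := single (val t).
by rewrite extend_val; case: (c t).
Qed.

(** [E] is covered by the finitely many cylinders over [Box] on which [A] holds, and independence
    makes the probability of a cylinder equal to its weight. *)
Lemma prob_le_Pr (E : set Omega) (A : configuration -> Prop) : measurable E ->
  (forall w, E w -> A (extend [ffun t : Box => X (val t) w])) ->
  (P E <= (Pr (site_law p q) Box A)%:E)%E.
Proof.
move=> mE EA.
pose U (s : seq {ffun Box -> state}) :=
  \big[setU/set0]_(c <- s | `[< A (extend c) >]) cylinder c.
have mU s : measurable (U s).
  by apply: bigsetU_measurable => c _; exact: measurable_cylinder.
have EU : E `<=` U (index_enum {ffun Box -> state}).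
  move=> w Ew; rewrite /U -bigcup_seq_cond.
  exists [ffun t : Box => X (val t) w].
    by rewrite /= mem_index_enum; apply/asboolP; exact: EA.
  move=> x xB /=; rewrite -[x in RHS]/(val [` xB]%fset) extend_val.
  by rewrite ffunE.
apply: le_trans (le_measure P _ _ EU) _; rewrite ?inE //.
rewrite /Pr -sumEFin; elim: (index_enum _) => [|c s IH].
  by rewrite /U !big_nil measure0.
rewrite /U !big_cons; case: ifP => // _.
apply: (@le_trans _ _ (P (cylinder c) + P (U s))%E).
  exact: (measureU2 _ (measurable_cylinder c) (mU s)).
by rewrite prob_cylinder leeD2l.
Qed.
End Transfer.

(** * Cells *)

Definition rect (x y : int) (m n : nat) : seq site :=
  [seq (x + a%:Z, y + b%:Z) | a <- iota 0 m, b <- iota 0 n].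

Lemma size_rect x y m n : size (rect x y m n) = (m * n)%N.
Proof. by rewrite size_allpairs !size_iota. Qed.

Lemma rect_uniq x y m n : uniq (rect x y m n).
Proof.
apply: allpairs_uniq; rewrite ?iota_uniq // => -[a b] [a' b'] _ _ [].
by move=> /addrI[->] /addrI[->].
Qed.

Lemma mem_rect x y m n (s : site) :
  (s \in rect x y m n) = (x <= s.1 < x + m%:Z) && (y <= s.2 < y + n%:Z).
Proof.
case: s => s1 s2; apply/allpairsP/andP => /= [[[a b]]|[x1 y1]].
  by rewrite !mem_iota /= => -[? ? [-> ->]]; lia.
exists (`|s1 - x|%N, `|s2 - y|%N); rewrite !mem_iota /=.
by split; [lia|lia|congr pair; lia].
Qed.

Definition box (W Y : nat) : {fset site} :=
  [fset s in rect (- W%:Z) (- Y%:Z) (2 * W).+1 (2 * Y).+1]%fset.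

Lemma in_box W Y x y : ((x, y) \in box W Y) = (- W%:Z <= x <= W%:Z) && (- Y%:Z <= y <= Y%:Z).
Proof. by rewrite in_fset mem_rect /=; lia. Qed.

Definition good_row (x y : int) (w b : nat) (c : configuration) : Prop :=
  (forall s, s \in rect x y (w + b) 1 -> c s <> Occupied) /\
  (exists2 s, s \in rect x y w 1 & c s = Closed).

(** The closed site lies in the first of three blocks of width [w]; its row crosses the other two,
    one of which will carry the vertical segment to the next level. *)
Definition good_cell (x y : int) (w h : nat) (c : configuration) : Prop :=
  exists u v : nat, [/\ (u < w)%N, (v < h)%N, c (x + u%:Z, y + v%:Z) = Closed &
    forall z : int, x + u%:Z <= z < x + (3 * w)%:Z -> c (z, y + v%:Z) <> Occupied].

Section Estimates.
Variables (R : realType) (p q : R) (Box : {fset site}).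
Hypothesis p_ge0 : 0 <= p.
Hypothesis q_ge0 : 0 <= q.
Hypothesis pq_le1 : p + q <= 1.

Local Notation mu := (site_law p q).
Local Notation Pr := (Pr mu Box).

Lemma law_ge0 s : 0 <= mu s.
Proof. by case: s; rewrite /= ?subr_ge0 ?lerBrDl. Qed.

Lemma law_sum : mu Occupied + mu Closed + mu Open = 1.
Proof. by rewrite /=; ring. Qed.

Lemma law_not_occupied : \sum_(t | `[< [set t | t <> Occupied] t >]) mu t = 1 - p.
Proof.
by rewrite big_mkcond big_state /= asboolF ?asboolT //=; ring.
Qed.

Lemma law_single s : \sum_(t | `[< [set s] t >]) mu t = mu s.
Proof.
rewrite (bigD1 s) /=; last exact/asboolP.
by rewrite big_pred0 ?addr0 // => t; case: asboolP => //= ->; rewrite eqxx.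
Qed.

Lemma Pr_unoccupied (s : seq site) : uniq s -> {subset s <= Box} ->
  Pr (fun c => forall x, x \in s -> c x <> Occupied) = (1 - p) ^+ size s.
Proof.
move=> us sB.
rewrite (Pr_sites law_ge0 law_sum (fun _ => [set t | t <> Occupied]) us sB).
by rewrite law_not_occupied big_const_seq count_predT -Monoid.iteropE.
Qed.

Lemma Pr_all_occupied (s : seq site) : uniq s -> {subset s <= Box} ->
  Pr (fun c => forall x, x \in s -> c x = Occupied) = p ^+ size s.
Proof.
move=> us sB.
rewrite (Pr_sites law_ge0 law_sum (fun _ => [set Occupied]) us sB).
by rewrite law_single big_const_seq count_predT -Monoid.iteropE.
Qed.

(** Subtract from an unoccupied row the case where its first [w] sites contain no closed one, that
    is, are all open. *)
Lemma Pr_good_row x y w b : {subset rect x y (w + b) 1 <= Box} ->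
  Pr (good_row x y w b) = (1 - p) ^+ (w + b) - (1 - p - q) ^+ w * (1 - p) ^+ b.
Proof.
move=> sB; set A := fun c : configuration =>
  forall s, s \in rect x y (w + b) 1 -> c s <> Occupied.
pose s1 := rect x y w 1; pose s2 := rect (x + w%:Z) y b 1.
have ins s : (s \in s1 ++ s2) = (s \in rect x y (w + b) 1).
  by rewrite mem_cat !mem_rect; lia.
have us : uniq (s1 ++ s2).
  rewrite cat_uniq !rect_uniq andbT; apply/hasPn => s; rewrite !mem_rect; lia.
have := Pr_split mu Box A (fun c => exists2 s, s \in s1 & c s = Closed).
rewrite Pr_unoccupied ?rect_uniq // size_rect muln1 => ->.
suff -> : Pr (fun c => A c /\ ~ exists2 s, s \in s1 & c s = Closed) =
    (1 - p - q) ^+ w * (1 - p) ^+ b by rewrite addrK.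
have -> : Pr (fun c => A c /\ ~ exists2 s, s \in s1 & c s = Closed) =
    Pr (fun c => forall s, s \in s1 ++ s2 ->
      (if s \in s1 then [set Open] else [set t | t <> Occupied]) (c s)).
  apply: (Pr_ext _ law_ge0) => c; split => [[Ac nC] s|H].
    rewrite ins => /Ac; case: ifPn => // s_s1; case E : (c s) => // _.
    by case: nC; exists s.
  split => [s|[s s_s1 cs]].
    by rewrite -ins => /H; case: ifPn => //= _ ->.
  by have := H s; rewrite mem_cat s_s1 /= cs => /(_ isT).
rewrite (Pr_sites law_ge0 law_sum (fun s => if s \in s1 then _ else _) us); last first.
  by move=> s; rewrite ins; exact: sB.
rewrite big_cat /=; congr (_ * _).
  rewrite (eq_big_seq (fun=> 1 - p - q)) => [|s ->]; last exact: law_single.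
  by rewrite big_const_seq count_predT -Monoid.iteropE size_rect muln1.
rewrite (eq_big_seq (fun=> 1 - p)) => [|s s_s2].
  by rewrite big_const_seq count_predT -Monoid.iteropE size_rect muln1.
rewrite ifN; first exact: law_not_occupied.
by move: s_s2; rewrite !mem_rect; lia.
Qed.

Definition row_rate (w b : nat) : R :=
  (1 - p) ^+ (w + b) - (1 - p - q) ^+ w * (1 - p) ^+ b.

Lemma determined_good_row x y w b :
  determined [set s | s \in rect x y (w + b) 1] (good_row x y w b).
Proof.
move=> c c' cc' [H1 [s s_in cs]]; split => [t t_in|].
  by rewrite -cc' //; exact: H1.
by exists s => //; rewrite -cc' //=; move: s_in; rewrite !mem_rect; lia.
Qed.

Lemma determined_not (D : set site) (A : configuration -> Prop) :
  determined D A -> determined D (fun c => ~ A c).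
Proof. by move=> dA c c' cc' nA /(dA c' c) Ac; apply/nA/Ac => x /cc'. Qed.

Lemma determined_good_cell x y w h :
  determined [set s | s \in rect x y (3 * w) h] (good_cell x y w h).
Proof.
move=> c c' cc' [u [v [uw vh cl ro]]]; exists u, v; split => //.
  by rewrite -cc' //= mem_rect /=; lia.
by move=> z zr; rewrite -cc' /= ?mem_rect /=; [exact: ro|lia].
Qed.

(** One good row makes a good cell, and the [h] rows are independent. *)
Lemma Pr_no_good_cell x y w h : {subset rect x y (3 * w) h <= Box} ->
  Pr (fun c => ~ good_cell x y w h c) <= (1 - row_rate w (2 * w)) ^+ h.
Proof.
move=> sB.
pose row v := fun c => ~ good_row x (y + v%:Z) w (2 * w) c.
apply: (@le_trans _ _ (Pr (fun c => forall v, v \in iota 0 h -> row v c))).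
  apply: (Pr_mono _ law_ge0) => c ncell v; rewrite mem_iota add0n /= => vh [H [[s1 s2]]].
  rewrite mem_rect /= => s_in cs; apply: ncell; exists `|s1 - x|%N, v; split => //.
  - by lia.
  - by rewrite -cs; congr (c (_, _)); lia.
  - by move=> z zr; apply: H; rewrite mem_rect /=; lia.
rewrite (Pr_forall _ law_ge0 law_sum
  (D := fun v : nat => [set s : site | s \in rect x (y + v%:Z) (w + 2 * w) 1])).
- rewrite big_seq (eq_bigr (fun=> 1 - row_rate w (2 * w))) => [|v].
    rewrite -big_seq big_const_seq count_predT -Monoid.iteropE size_iota.
    exact: lexx.
  rewrite mem_iota => /= vh; rewrite (Pr_not _ law_ge0 law_sum) Pr_good_row //.
  by move=> [s1 s2]; rewrite mem_rect /= => sr; apply: sB; rewrite mem_rect /=; lia.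
- exact: iota_uniq.
- by move=> v _; apply: determined_not; exact: determined_good_row.
- by move=> v v' [s1 s2] _ _ /=; rewrite !mem_rect /=; lia.
Qed.

Section Walls.
Variables (x0 y0 : int) (w h M n : nat).

(* The [i]-th cell of level [j] lives in the sub-band [i %% 3] of that level and
   spans three block columns, so that distinct cells involve disjoint sites. *)
Definition cell (i j : nat) (c : configuration) : Prop :=
  good_cell (x0 + (i * w)%:Z) (y0 + (j * (3 * h) + (i %% 3) * h)%:Z) w h c.

Hypothesis cellsB : forall i j, (i < M)%N -> (j < n)%N ->
  {subset rect (x0 + (i * w)%:Z) (y0 + (j * (3 * h) + (i %% 3) * h)%:Z) (3 * w) h <= Box}.

Lemma cells_disjoint (z z' : nat * nat) (s : site) :
  s \in rect (x0 + (z.1 * w)%:Z) (y0 + (z.2 * (3 * h) + (z.1 %% 3) * h)%:Z) (3 * w) h ->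
  s \in rect (x0 + (z'.1 * w)%:Z) (y0 + (z'.2 * (3 * h) + (z'.1 %% 3) * h)%:Z) (3 * w) h ->
  z = z'.
Proof.
case: z z' s => [i j] [i' j'] [s1 s2]; rewrite !mem_rect /= => /andP[s1x s2y] /andP[s1x' s2y'].
(* The height determines the sub-band, hence [j] and [i] modulo 3; horizontally, two overlapping
   triples of blocks have indices less than 3 apart. *)
have eqj : (j * 3 + i %% 3 = j' * 3 + i' %% 3)%N.
  by nia.
have [ej ei] : j = j' /\ (i %% 3 = i' %% 3)%N by lia.
congr pair; last exact: ej.
have : (i < i' + 3)%N by nia.
have : (i' < i + 3)%N by nia.
lia.
Qed.

Lemma Pr_no_cells (Z : seq (nat * nat)) :
  uniq Z -> all (fun z => (z.1 < M) && (z.2 < n))%N Z ->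
  Pr (fun c => forall z, z \in Z -> ~ cell z.1 z.2 c)
    <= ((1 - row_rate w (2 * w)) ^+ h) ^+ size Z.
Proof.
move=> uZ /allP gZ; rewrite (Pr_forall _ law_ge0 law_sum
  (D := fun z : nat * nat => [set s : site | s \in
    rect (x0 + (z.1 * w)%:Z) (y0 + (z.2 * (3 * h) + (z.1 %% 3) * h)%:Z) (3 * w) h])) //.
- have -> : ((1 - row_rate w (2 * w)) ^+ h) ^+ size Z =
      \prod_(z <- Z) ((1 - row_rate w (2 * w)) ^+ h).
    by rewrite big_const_seq count_predT -Monoid.iteropE.
  rewrite big_seq [leRHS]big_seq; apply: ler_prod => z zZ; apply/andP; split.
    exact: Pr_ge0 _ law_ge0 _.
  by have /andP[? ?] := gZ _ zZ; apply: Pr_no_good_cell; exact: cellsB.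
- by move=> z _; apply: determined_not; exact: determined_good_cell.
- by move=> z z' s _ _ /= sz sz'; exact: cells_disjoint sz sz'.
Qed.
End Walls.
End Estimates.

(** * Probabilities of the building blocks *)

Section Events.
Variables (R : realType) (p q : R) (Box : {fset site}).
Hypothesis p_ge0 : 0 <= p.
Hypothesis q_ge0 : 0 <= q.
Hypothesis pq_le1 : p + q <= 1.

Local Notation mu := (site_law p q).
Local Notation Pr := (Pr mu Box).
Let mu_ge0 := law_ge0 p_ge0 q_ge0 pq_le1.
Let mu_sum := law_sum p q.

Lemma sum_const_seq (T : Type) (s : seq T) (a : R) :
  \sum_(i <- s) a = (size s)%:R * a.
Proof. by rewrite big_const_seq count_predT -Monoid.iteropE mulr_natl. Qed.

Lemma geometric_le2 (x : R) (N : nat) : 0 <= x -> x <= 2^-1 ->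
  \sum_(m <- iota 0 N) x ^+ m <= 2.
Proof.
move=> x0 x2; suff : \sum_(m <- iota 0 N) x ^+ m <= 2 - 2 * 2^-1 ^+ N.
  by move=> /le_trans; apply; rewrite gerBl mulr_ge0 // exprn_ge0 // invr_ge0.
elim: N => [|N IH]; first by rewrite big_nil expr0 mulr1 subrr.
rewrite -addn1 iotaD big_cat big_seq1 /= add0n addn1.
have : x ^+ N <= 2^-1 ^+ N by apply: lerXn2r; rewrite ?nnegrE ?invr_ge0.
rewrite exprS mulrA divff // mul1r; lra.
Qed.

Lemma Pr_false (A : configuration -> Prop) : (forall c, ~ A c) -> Pr A = 0.
Proof.
move=> nA; rewrite (Pr_ext _ mu_ge0 (B := fun=> ~ True)) => [|c]; last first.
  by split => // Ac; case: (nA c).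
by rewrite (Pr_not _ mu_ge0 mu_sum) Pr_true ?subrr.
Qed.

(** Peierls argument: a blocking walk of [m] steps passes through [(m + M) / 2] distinct failing
    cells, which has probability at most [delta ^+ (m + M)]. There are [3 ^ m] walks from each of
    [n] starting points, and the series in [3 * delta] is at most 2. *)
Lemma Pr_no_lipschitz (x0 y0 : int) (w h M n : nat) (delta : R) :
  (forall i j, (i < M)%N -> (j < n)%N ->
    {subset rect (x0 + (i * w)%:Z) (y0 + (j * (3 * h) + (i %% 3) * h)%:Z) (3 * w) h <= Box}) ->
  0 <= delta -> 3 * delta <= 2^-1 ->
  0 <= (1 - row_rate p q w (2 * w)) ^+ h <= delta ^+ 2 ->
  Pr (fun c => ~ exists F : nat -> nat,
    [/\ forall j, (j < n)%N -> (F j < M)%N /\ cell x0 y0 w h (F j) j c &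
        forall j, (j.+1 < n)%N -> (F j <= (F j.+1).+1)%N /\ (F j.+1 <= (F j).+1)%N])
  <= 2 * n%:R * delta ^+ M.
Proof.
move=> cellsB d0 d3 /andP[e0 ed].
pose blocked (j m : nat) (pth : seq (nat * nat)) (c : configuration) :=
  let Z := ascents (0, j)%N pth in
  [/\ uniq Z, (2 * size Z = m + M)%N, all (fun z => (z.1 < M) && (z.2 < n))%N Z &
      forall z, z \in Z -> ~ cell x0 y0 w h z.1 z.2 c].
apply: (@le_trans _ _ (Pr (fun c => exists2 j, j \in iota 0 n & exists2 m, m \in iota 0 (M.+1 * n) &
    exists2 pth, pth \in walks m (0, j)%N & blocked j m pth c))).
  apply: (Pr_mono _ mu_ge0) => c noF.
  have [|j jn [m mB [pth pw [u1 u2 u3]]]] :=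
      @blocking_walk M n (fun i j => ~~ `[< cell x0 y0 w h i j c >]).
    move=> [F [F1 F2]]; apply: noF; exists F; split => // j jn.
    by have [? /negbNE/asboolP] := F1 j jn.
  exists j; first by rewrite mem_iota.
  exists m; first by rewrite mem_iota.
  exists pth => //; split => //.
    by apply: sub_all u3 => z /and3P[-> ->].
  by move=> z /(allP u3)/and3P[_ _ /asboolPn].
have bl j m pth : Pr (blocked j m pth) <= delta ^+ (m + M).
  rewrite /blocked; set Z := ascents _ _.
  have [/and3P[uZ /eqP sZ aZ]|bad] :=
      boolP [&& uniq Z, (2 * size Z == m + M)%N & all (fun z => (z.1 < M) && (z.2 < n))%N Z].
    apply: le_trans (_ : _ <= Pr (fun c => forall z, z \in Z -> ~ cell x0 y0 w h z.1 z.2 c)) _.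
      by apply: (Pr_mono _ mu_ge0) => c [].
    apply: le_trans (Pr_no_cells p_ge0 q_ge0 pq_le1 cellsB uZ aZ) _.
    rewrite -sZ exprM; apply: lerXn2r => //; rewrite nnegrE //.
    exact: exprn_ge0.
  rewrite Pr_false ?exprn_ge0 // => c [uZ sZ aZ _].
  by move/negP: bad; apply; rewrite uZ sZ eqxx aZ.
apply: le_trans (Pr_exists _ mu_ge0 mu_sum _ _) _.
apply: (@le_trans _ _ (\sum_(j <- iota 0 n) 2 * delta ^+ M)); last first.
  by rewrite sum_const_seq size_iota mulrCA mulrA.
apply: ler_sum => j _; apply: le_trans (Pr_exists _ mu_ge0 mu_sum _ _) _.
apply: (@le_trans _ _ (\sum_(m <- iota 0 (M.+1 * n)) (3 * delta) ^+ m * delta ^+ M)).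
  apply: ler_sum => m _; apply: le_trans (Pr_exists _ mu_ge0 mu_sum _ _) _.
  apply: le_trans (ler_sum _ (fun pth _ => bl j m pth)) _.
  rewrite sum_const_seq size_walks.
  by rewrite exprMn exprD mulrA natrX.
rewrite -mulr_suml ler_wpM2r ?exprn_ge0 //; apply: geometric_le2 => //.
by rewrite mulr_ge0.
Qed.

Definition free_column (x y : int) (t N m : nat) (c : configuration) : Prop :=
  exists2 s, s \in iota 0 N &
    forall z, z \in rect (x + (s * t)%:Z) y t m -> c z <> Occupied.

Lemma Pr_no_free_column (x y : int) (t N m : nat) :
  {subset rect x y (N * t) m <= Box} ->
  Pr (fun c => ~ free_column x y t N m c) = (1 - (1 - p) ^+ (t * m)) ^+ N.
Proof.
move=> sB; transitivity (Pr (fun c => forall s, s \in iota 0 N ->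
    ~ (forall z, z \in rect (x + (s * t)%:Z) y t m -> c z <> Occupied))).
  apply: (Pr_ext _ mu_ge0) => c; split => [nf s sN fr|H [s sN fr]].
    by apply: nf; exists s.
  exact: H sN fr.
rewrite (Pr_forall _ mu_ge0 mu_sum
  (D := fun s : nat => [set z : site | z \in rect (x + (s * t)%:Z) y t m])).
- rewrite (eq_big_seq (fun=> 1 - (1 - p) ^+ (t * m))) => [|s].
    by rewrite big_const_seq count_predT size_iota -Monoid.iteropE.
  rewrite mem_iota => /= sN; rewrite (Pr_not _ mu_ge0 mu_sum) Pr_unoccupied ?rect_uniq //.
    by rewrite size_rect.
  move=> z zr; apply: sB; move: zr; rewrite !mem_rect; nia.
- exact: iota_uniq.
- move=> s _; apply: determined_not => c c' cc' H z zr.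
  by rewrite -cc' //; exact: H.
- move=> s s' z _ _ /=; rewrite !mem_rect => /andP[z1 _] /andP[z2 _]; nia.
Qed.

Definition lid_at (W : nat) (c : configuration) (y : int) : Prop :=
  [/\ c (- W%:Z, y) = Closed, c (W%:Z, y) = Closed &
      forall x : int, - W%:Z <= x <= W%:Z -> c (x, y) <> Occupied].

Lemma Pr_lid (W : nat) (y : int) : (0 < W)%N ->
  {subset rect (- W%:Z) y (2 * W).+1 1 <= Box} ->
  Pr (fun c => lid_at W c y) = q ^+ 2 * (1 - p) ^+ (2 * W).-1.
Proof.
move=> W0 sB.
pose s := [:: (- W%:Z, y), (W%:Z, y) & rect (- W%:Z + 1) y (2 * W).-1 1].
pose B (z : site) : set state :=
  if (z.1 == - W%:Z) || (z.1 == W%:Z) then [set Closed] else [set t | t <> Occupied].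
have us : uniq s by rewrite /= rect_uniq inE !mem_rect xpair_eqE /=; lia.
have sB' : {subset s <= Box}.
  move=> z; rewrite !inE => /or3P[/eqP->|/eqP->|zs]; apply: sB.
  - by rewrite mem_rect /=; lia.
  - by rewrite mem_rect /=; lia.
  - by move: zs; rewrite !mem_rect; lia.
transitivity (Pr (fun c => forall z, z \in s -> B z (c z))).
  apply: (Pr_ext _ mu_ge0) => c; split => [[c1 c2 c3] [z1 z2]|H].
    rewrite !inE mem_rect !xpair_eqE /B /= => zs.
    case: ifPn => [/orP[/eqP E|/eqP E]|zn]; rewrite ?E /=.
    - by have -> : z2 = y by lia.
    - by have -> : z2 = y by lia.
    - by have -> : z2 = y by [lia]; apply: c3; lia.
  have c1 : c (- W%:Z, y) = Closed.
    by have := H (- W%:Z, y); rewrite mem_head /B /= eqxx; exact.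
  have c2 : c (W%:Z, y) = Closed.
    by have := H (W%:Z, y); rewrite inE mem_head orbT /B /= eqxx orbT; exact.
  split => // x xW.
  have [->|x1] := eqVneq x (- W%:Z); first by rewrite c1.
  have [->|x2] := eqVneq x (W%:Z); first by rewrite c2.
  have := H (x, y); rewrite /B /= (negPf x1) (negPf x2) /=; apply.
  by rewrite !inE mem_rect /=; lia.
rewrite (Pr_sites mu_ge0 mu_sum B us sB') /s !big_cons /B /= !eqxx orbT /= !law_single.
rewrite mulrA -expr2; congr (_ * _).
rewrite (eq_big_seq (fun=> 1 - p)) => [|z].
  by rewrite big_const_seq count_predT -Monoid.iteropE size_rect muln1.
rewrite mem_rect => zr; rewrite ifN; first exact: law_not_occupied.
by move: zr; lia.
Qed.

Lemma Pr_no_lid (W : nat) (y : int) (N : nat) : (0 < W)%N ->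
  {subset rect (- W%:Z) y (2 * W).+1 N <= Box} ->
  Pr (fun c => ~ exists2 s, (s < N)%N & lid_at W c (y + s%:Z)) =
    (1 - q ^+ 2 * (1 - p) ^+ (2 * W).-1) ^+ N.
Proof.
move=> W0 sB; transitivity (Pr (fun c => forall s, s \in iota 0 N -> ~ lid_at W c (y + s%:Z))).
  apply: (Pr_ext _ mu_ge0) => c; split => [nf s|H [s sN ls]].
    by rewrite mem_iota => /= sN ls; apply: nf; exists s.
  by apply: (H s) => //; rewrite mem_iota.
rewrite (Pr_forall _ mu_ge0 mu_sum
  (D := fun s : nat => [set z : site | z.2 = y + s%:Z])).
- rewrite (eq_big_seq (fun=> 1 - q ^+ 2 * (1 - p) ^+ (2 * W).-1)) => [|s].
    by rewrite big_const_seq count_predT size_iota -Monoid.iteropE.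
  rewrite mem_iota => /= sN; rewrite (Pr_not _ mu_ge0 mu_sum) Pr_lid //.
  by move=> z; rewrite mem_rect => zr; apply: sB; rewrite mem_rect; lia.
- exact: iota_uniq.
- move=> s _; apply: determined_not => c c' cc' [c1 c2 c3].
  by split => [||x xW]; rewrite -cc' //; exact: c3.
- by move=> s s' z _ _ /= -> /addrI[].
Qed.

Fixpoint words (T : Type) (r : nat) (s : seq T) : seq (seq T) :=
  if r is r'.+1 then [seq x :: u | x <- s, u <- words r' s] else [:: [::]].

Lemma size_words (T : Type) r (s : seq T) : size (words r s) = (size s ^ r)%N.
Proof.
elim: r => [//|r IH]; rewrite [words _ _]/=.
by rewrite (size_allpairs cons) IH expnS.
Qed.

Lemma mem_words (T : eqType) (s u : seq T) : {subset u <= s} -> u \in words (size u) s.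
Proof.
elim: u => [//|x u IH] us; rewrite [words _ _]/=; apply/allpairsP; exists (x, u).
split => //=; first by apply: us; rewrite mem_head.
by apply: IH => y yu; apply: us; rewrite inE yu orbT.
Qed.

(** A violation provides [r] occupied sites within distance [4 * r] of one of them in each
    coordinate: sum over that site and over the words of length [r] in its window. *)
Lemma Pr_not_sparse (r : nat) (L : seq site) : (0 < r)%N -> {subset L <= Box} ->
  Pr (fun c => ~ sparse r [seq s <- L | is_occupied (c s)]) <=
    (size L)%:R * (((8 * r).+1 * (8 * r).+1) ^ r)%:R * p ^+ r.
Proof.
move=> r0 LB.
pose window (z : site) := rect (z.1 - (4 * r)%:Z) (z.2 - (4 * r)%:Z) (8 * r).+1 (8 * r).+1.
pose full (A : seq site) (c : configuration) :=
  [/\ uniq A, size A = r, {subset A <= Box} & forall z, z \in A -> c z = Occupied].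
apply: (@le_trans _ _ (Pr (fun c =>
    exists2 z, z \in L & exists2 A, A \in words r (window z) & full A c))).
  apply: (Pr_mono _ mu_ge0) => c /existsNP[A /existsNP[Q]] /not_implyP[uA].
  move=> /not_implyP[AO] /not_implyP[rA] /not_implyP[AQ /negP]; rewrite -leNgt => sQ.
  case: A uA AO rA AQ => [|z A]; first by rewrite leqNgt r0.
  set A' := z :: A => uA AO rA AQ.
  have zL : z \in L by have := AO z (mem_head _ _); rewrite mem_filter => /andP[].
  exists z => //; exists (take r A').
    rewrite -[r in words r](size_takel rA); apply: mem_words => u /mem_take uA'.
    have := allP AQ _ uA'; have := allP AQ _ (mem_head z A).
    rewrite mem_rect; case: (Q) sQ => [[[a b] d] e] /=; case: (u) (z) => [u1 u2] [z1 z2] /=.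
    lia.
  split; [exact: take_uniq|exact: size_takel| |] => u /mem_take/AO.
    by rewrite mem_filter => /andP[_ /LB].
  by rewrite mem_filter => /andP[]; case: (c u).
apply: le_trans (Pr_exists _ mu_ge0 mu_sum _ _) _.
apply: (@le_trans _ _ (\sum_(z <- L) (((8 * r).+1 * (8 * r).+1) ^ r)%:R * p ^+ r)); last first.
  by rewrite sum_const_seq mulrA.
apply: ler_sum => z _; apply: le_trans (Pr_exists _ mu_ge0 mu_sum _ _) _.
apply: (@le_trans _ _ (\sum_(A <- words r (window z)) p ^+ r)); last first.
  by rewrite sum_const_seq size_words size_rect.
apply: ler_sum => A _.
have [[uA sA AB]|nA] := pselect [/\ uniq A, size A = r & {subset A <= Box}]; last first.
  by rewrite Pr_false ?exprn_ge0 // => c [? ? ? _]; exact: nA.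
rewrite -sA -(Pr_all_occupied p_ge0 q_ge0 pq_le1 uA AB).
by apply: (Pr_mono _ mu_ge0) => c [].
Qed.

Lemma Pr_some_occupied (L : seq site) : {subset L <= Box} ->
  Pr (fun c => exists2 s, s \in L & c s = Occupied) <= (size L)%:R * p.
Proof.
move=> LB; apply: le_trans (Pr_exists _ mu_ge0 mu_sum _ _) _.
rewrite big_seq (eq_bigr (fun=> p)) => [|s /LB sB].
  by rewrite -big_seq sum_const_seq.
by rewrite (Pr_site mu_sum [set Occupied] sB) law_single.
Qed.
End Events.

(** * Good configurations *)

Section GoodConfiguration.
Variables (r w h M n0 N : nat).

(** [k] is the reach of the growth in [sparse_closure]; [t] is the width of a column with [k.+1]
    further sites on each side; [W] makes room for [M] overlapping triples of blocks left of the
    origin; [m] is the height of the [n0] levels below height 0. *)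
Let k := (2 * r)%N.
Let t := (2 * k + 3)%N.
Let W := ((M + 3) * w)%N.
Let m := (n0 * (3 * h))%N.
Let Y := (m + 6 * h + k + 5)%N.
Let n := (2 * n0).+1.
Let x0 : int := - W%:Z.
Let y0 : int := - m%:Z.

Definition lipschitz_cells (c : configuration) : Prop := exists F : nat -> nat,
  [/\ forall j, (j < n)%N -> (F j < M)%N /\ cell x0 y0 w h (F j) j c &
      forall j, (j.+1 < n)%N -> (F j <= (F j.+1).+1)%N /\ (F j.+1 <= (F j).+1)%N].

(** Two levels of height [3 * h] with a margin [k.+1] at both ends: enough to join any row of level
    [j] to any row of the next. *)
Definition level_column (i j : nat) (c : configuration) : Prop :=
  free_column (x0 + (i * w)%:Z) (y0 + (j * (3 * h))%:Z - k.+1%:Z) t N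
    (6 * h + 2 * k + 3) c.

(** Columns are required in all blocks up to [M], because the block in which the wall needs one
    depends on [F]. *)
Definition wall_good (c : configuration) : Prop :=
  lipschitz_cells c /\
  forall z, z \in [seq (i, j) | i <- iota 0 M.+1, j <- iota 0 n] -> level_column z.1 z.2 c.

Definition good_configuration (c : configuration) : Prop :=
  [/\ wall_good c /\ wall_good (c \o reflect),
      exists2 s, (s < m)%N & lid_at W c (y0 + s%:Z),
      exists2 s, (s < m)%N & lid_at W c ((3 * h)%:Z + s%:Z),
      sparse r [seq s <- rect (- W%:Z) (- Y%:Z) (2 * W).+1 (2 * Y).+1 | is_occupied (c s)] &
      ~ exists2 s, s \in rect (- k%:Z) (- k%:Z) (2 * k).+1 (2 * k).+1 & c s = Occupied].

Hypotheses (h_gt0 : (0 < h)%N) (w_gt0 : (0 < w)%N) (Nt : (N * t <= w)%N).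

Lemma wall_good_left_wall (c : configuration) (J0 J1 : nat) (bot top : int) :
  wall_good c -> (J0 < J1 < n)%N ->
  y0 + (J0 * (3 * h))%:Z <= bot < y0 + (J0.+1 * (3 * h))%:Z ->
  y0 + (J1 * (3 * h))%:Z <= top < y0 + (J1.+1 * (3 * h))%:Z ->
  lid_at W c bot -> lid_at W c top ->
  exists r B X : nat -> int,
    [/\ left_wall k W%:Z c J0 J1 r B X, r J0 = bot & r J1 = top].
Proof.
move=> [[F [F1 F2]] cols] JJ botb topb [l1 _ l3] [l4 _ l6].
have /choice[b bP] : forall j, exists b : int * int, (j < n)%N ->
    [/\ x0 + (F j * w)%:Z <= b.1 < x0 + (F j * w)%:Z + w%:Z,
        y0 + (j * (3 * h))%:Z <= b.2 < y0 + (j.+1 * (3 * h))%:Z,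
        c (b.1, b.2) = Closed &
        forall z, b.1 <= z < x0 + (F j * w)%:Z + (3 * w)%:Z -> c (z, b.2) <> Occupied].
  move=> j; have [jn|jn] := ltnP j n; last by exists (0, 0).
  have [_ [u [v [uw vh cl ro]]]] := F1 j jn.
  have : ((F j %% 3) * h <= 2 * h)%N by rewrite leq_mul2r; lia.
  by exists (x0 + (F j * w)%:Z + u%:Z, y0 + (j * (3 * h) + (F j %% 3) * h)%:Z + v%:Z);
    move=> _; split => //=; lia.
(* Since [F j] and [F j.+1] differ by at most one, this block is the second or third of both cells,
   so both rows cross it. *)
pose i j := (maxn (F j) (F j.+1)).+1.
have /choice[X XP] : forall j, exists X : int, (j.+1 < n)%N ->
    x0 + (i j * w)%:Z <= X < x0 + (i j * w)%:Z + w%:Z /\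
    forall x y : int, `|x - X| <= k.+1%:Z ->
      y0 + (j * (3 * h))%:Z - k.+1%:Z <= y <= y0 + (j.+2 * (3 * h))%:Z + k.+1%:Z ->
      c (x, y) <> Occupied.
  move=> j; have [jn|jn] := ltnP j.+1 n; last by exists 0.
  have [|s sN fr] := cols (i j, j).
    apply/allpairsP; exists (i j, j); rewrite !mem_iota /=; split => //; last by lia.
    by have := F1 j; have := F1 j.+1; rewrite /i; lia.
  exists (x0 + (i j * w)%:Z + (s * t)%:Z + k.+1%:Z) => _; split.
    move: sN; rewrite mem_iota /= => sN; have : (s.+1 * t <= w)%N.
      by apply: leq_trans Nt; rewrite leq_mul2r; lia.
    by rewrite mulSn /t; lia.
  by move=> x y xX yy; apply: fr; rewrite mem_rect /= /t; lia.
(* At levels [J0] and [J1] the lids replace the rows of the cells, and their closed end at [- W]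
   becomes the start [B]. *)
pose r' j := if j == J0 then bot else if j == J1 then top else (b j).2.
pose B j := if (j == J0) || (j == J1) then - W%:Z else (b j).1.
have r'b j : (J0 <= j <= J1)%N -> y0 + (j * (3 * h))%:Z <= r' j < y0 + (j.+1 * (3 * h))%:Z.
  move=> jJ; rewrite /r'; case: eqVneq => [->//|_]; case: eqVneq => [->//|_].
  by have [] := bP j; lia.
have Bb j : (J0 <= j <= J1)%N -> - W%:Z <= B j < x0 + (F j * w)%:Z + w%:Z.
  by move=> jJ; rewrite /B /x0; case: ifP => _; [lia|have [] := bP j; lia].
have Wx : x0 + ((M + 3) * w)%:Z = 0 by rewrite /x0 /W; lia.
have Xb j : (J0 <= j < J1)%N ->
    [/\ x0 + (F j * w)%:Z + w%:Z <= X j < x0 + (F j * w)%:Z + (3 * w)%:Z,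
        x0 + (F j.+1 * w)%:Z + w%:Z <= X j < x0 + (F j.+1 * w)%:Z + (3 * w)%:Z &
        X j < 0].
  move=> jJ; have [//|Xj _] := XP j; first by lia.
  have [f1 _] := F1 j ltac:(lia); have [f2 _] := F1 j.+1 ltac:(lia).
  have [f3 f4] := F2 j ltac:(lia).
  have a1 : (F j * w + w <= i j * w)%N by rewrite -mulSnr leq_mul2r /i; lia.
  have a2 : (F j.+1 * w + w <= i j * w)%N by rewrite -mulSnr leq_mul2r /i; lia.
  have a3 : (i j * w <= F j * w + 2 * w)%N by rewrite -mulnDl leq_mul2r /i; lia.
  have a4 : (i j * w <= F j.+1 * w + 2 * w)%N by rewrite -mulnDl leq_mul2r /i; lia.
  have a5 : (i j * w <= (M + 1) * w)%N by rewrite leq_mul2r /i; lia.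
  by split; lia.
have row j x : (J0 <= j <= J1)%N -> B j <= x < x0 + (F j * w)%:Z + (3 * w)%:Z ->
    c (x, r' j) <> Occupied.
  move=> jJ xr.
  have xW : x < 0.
    have [f1 _] := F1 j ltac:(lia).
    have : ((F j + 3) * w <= (M + 3) * w)%N by rewrite leq_mul2r; lia.
    by move: xr Wx; rewrite mulnDl; lia.
  move: xr; rewrite /B /r'; case: eqVneq => [_ /= xr|_ /=]; first by apply: l3; lia.
  case: eqVneq => [_ /= xr|_ /= xr]; first by apply: l6; lia.
  by have [_ _ _] := bP j ltac:(lia); apply; lia.
exists r', B, X; split; last 2 first.
- by rewrite /r' eqxx.
- by rewrite /r' eqxx; case: eqVneq => [E|//]; move: JJ; rewrite E; lia.
constructor=> [j jJ|j jJ|j jJ|j x jJ xr|j x jJ xr|j x y jJ xX yr].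
- by have := r'b j; have := r'b j.+1; lia.
- have [X1 X2 X3] := Xb j jJ.
  by have := Bb j; have := Bb j.+1; split => //; lia.
- split; first by have := Bb j jJ; lia.
  rewrite /B /r'; case: eqVneq => [_|_] //=; case: eqVneq => [_|_] //=.
  by have [_ _] := bP j ltac:(lia).
- by have [X1 X2 X3] := Xb j jJ; apply: row; lia.
- by have [X1 X2 X3] := Xb j jJ; apply: row; lia.
- have [_] := XP j ltac:(lia); apply => //.
  by have := r'b j; have := r'b j.+1; lia.
Qed.

Lemma good_configuration_safe (c : configuration) :
  (1 < r)%N -> (0 < n0)%N -> good_configuration c ->
  exists V : set site, [/\ stable_set c V, V origin &
    forall x y, V (x, y) -> (x, y) \in box W Y].
Proof.
move=> r1 n00 [[wl wr] [s sm lbot] [s' sm' ltop] sp no].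
set bot := y0 + s%:Z in lbot; set top := (3 * h)%:Z + s'%:Z in ltop.
have h3 : (0 < 3 * h)%N by lia.
(* Level [n0] starts at height 0; the bottom lid lies in a lower level, the top lid in a higher
   one. *)
pose J0 := (s %/ (3 * h))%N; pose J1 := (n0.+1 + s' %/ (3 * h))%N.
have J0n : (J0 < n0)%N by rewrite ltn_divLR.
have J1n : (J1 < n)%N.
  by have : (s' %/ (3 * h) < n0)%N; [rewrite ltn_divLR|rewrite /J1 /n; lia].
have botb : y0 + (J0 * (3 * h))%:Z <= bot < y0 + (J0.+1 * (3 * h))%:Z.
  have := divn_eq s (3 * h); have := ltn_pmod s h3; rewrite /bot -/J0; lia.
have topb : y0 + (J1 * (3 * h))%:Z <= top < y0 + (J1.+1 * (3 * h))%:Z.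
  have := divn_eq s' (3 * h); have := ltn_pmod s' h3.
  rewrite /top /y0 /m /J1; nia.
have JJ : (J0 < J1 < n)%N.
  rewrite J1n andbT /J1; apply: leq_trans J0n _.
  by rewrite addSn; exact: leqW (leq_addr _ _).
have refl_lid y : lid_at W c y -> lid_at W (c \o reflect) y.
  move=> [c1 c2 c3]; split; rewrite /= /reflect /= ?opprK //.
  by move=> x xW; apply: c3; lia.
have [ry [B [X [left E1 E3]]]] := wall_good_left_wall wl JJ botb topb lbot ltop.
have [ry' [B' [X' [right E2 E4]]]] :=
  wall_good_left_wall wr JJ botb topb (refl_lid _ lbot) (refl_lid _ ltop).
have [K [Kc Kocc Knear]] := sparse_closure r1 (filter_uniq _ (rect_uniq _ _ _ _)) sp.
have ltJ : (J0 < J1)%N by lia.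
have ends : [/\ ry J0 = bot, ry' J0 = bot, ry J1 = top & ry' J1 = top] by [].
have lids : forall y : int, y = bot \/ y = top ->
    [/\ c (- W%:Z, y) = Closed, c (W%:Z, y) = Closed &
        forall x : int, - W%:Z <= x <= W%:Z -> c (x, y) <> Occupied].
  by move=> y [->|->].
have bd : - Y%:Z <= bot /\ top <= Y%:Z /\ bot < 0 /\ 0 < top.
  rewrite /bot /top /y0 /Y; lia.
have occK : forall x y : int, - W%:Z <= x <= W%:Z -> bot <= y <= top ->
    c (x, y) = Occupied -> K (x, y).
  move=> x y xW yb cO; apply: Kocc; rewrite mem_filter cO /= mem_rect /=; lia.
have nearK : forall x y : int, K (x, y) -> exists2 z : site, c z = Occupied &
    `|z.1 - x| <= k%:Z /\ `|z.2 - y| <= k%:Z.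
  move=> x y /Knear[z]; rewrite mem_filter => /andP[zO _] zd; exists z => //.
  by case: (c z) zO.
have b1 := chamber_bound (c := c) left right ltJ ends.
have b2 := stable_chamber left right ltJ ends lids Kc occK nearK.
have b3 := chamber_origin left right ltJ ends.
eexists; split; [exact: b2| |].
  apply: b3; first by lia.
  move=> /Knear[[z1 z2]]; rewrite mem_filter => /andP[zO _] [/= d1 d2]; apply: no.
  by exists (z1, z2); [rewrite mem_rect /=; lia|case: (c (z1, z2)) zO].
by move=> x y /b1 Vxy; rewrite in_box; lia.
Qed.
End GoodConfiguration.

(** * Failure probability of good configurations *)

Section GoodProbability.
Variables (R : realType) (p q delta : R) (r w h M n0 N : nat).
Hypothesis p_ge0 : 0 <= p.
Hypothesis q_ge0 : 0 <= q.
Hypothesis pq_le1 : p + q <= 1.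

Let k := (2 * r)%N.
Let t := (2 * k + 3)%N.
Let W := ((M + 3) * w)%N.
Let m := (n0 * (3 * h))%N.
Let Y := (m + 6 * h + k + 5)%N.
Let n := (2 * n0).+1.
Let Box := box W Y.
Let mu_ge0 := law_ge0 p_ge0 q_ge0 pq_le1.
Let mu_sum := law_sum p q.

Hypotheses (r_gt0 : (0 < r)%N) (Nt : (N * t <= w)%N) (kw : (k <= w)%N) (w_gt0 : (0 < w)%N).
Hypotheses (delta_ge0 : 0 <= delta) (delta_small : 3 * delta <= 2^-1).
Hypothesis cell_fail : 0 <= (1 - row_rate p q w (2 * w)) ^+ h <= delta ^+ 2.

Local Notation Pr := (Pr (site_law p q) Box).

Lemma Pr_not_wall_good : Pr (fun c => ~ wall_good r w h M n0 N c) <=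
  2 * n%:R * delta ^+ M +
  (M.+1 * n)%:R * (1 - (1 - p) ^+ (t * (6 * h + 2 * k + 3))) ^+ N.
Proof.
pose ij := [seq (i, j) | i <- iota 0 M.+1, j <- iota 0 n].
apply: (@le_trans _ _ (Pr (fun c => ~ lipschitz_cells w h M n0 c) +
    Pr (fun c => exists2 z, z \in ij & ~ level_column r w h M n0 N z.1 z.2 c))).
  apply: le_trans (Pr_or _ mu_ge0 _ _); apply: (Pr_mono _ mu_ge0) => c nw.
  apply: contrapT => /not_orP[/contrapT H1 H2]; apply: nw; split => // z zij.
  by apply: contrapT => nz; apply: H2; exists z.
apply: lerD.
  apply: (Pr_no_lipschitz p_ge0 q_ge0 pq_le1 _ delta_ge0 delta_small cell_fail).
  move=> i j iM jn [s1 s2]; rewrite mem_rect in_box /=.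
  have : (i * w + 3 * w <= (M + 3) * w)%N by rewrite -mulnDl leq_mul2r; lia.
  have : ((i %% 3) * h <= 2 * h)%N by rewrite leq_mul2r; lia.
  have : (j * (3 * h) <= (2 * n0) * (3 * h))%N by rewrite leq_mul2r; lia.
  rewrite /Y /W /m; lia.
apply: le_trans (Pr_exists _ mu_ge0 mu_sum _ _) _.
rewrite big_seq (eq_bigr (fun=> (1 - (1 - p) ^+ (t * (6 * h + 2 * k + 3))) ^+ N)).
  by rewrite -big_seq sum_const_seq size_allpairs !size_iota.
move=> [i j] /allpairsP[[i' j'] []]; rewrite !mem_iota /= => iM jn [-> ->].
apply: Pr_no_free_column => // -[s1 s2]; rewrite mem_rect in_box /=.
have : (i' * w + w <= (M + 3) * w)%N by rewrite -mulSnr leq_mul2r; lia.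
have : (j' * (3 * h) <= (2 * n0) * (3 * h))%N by rewrite leq_mul2r; lia.
move: Nt; rewrite -/k -/t /Y /W /m; lia.
Qed.

Lemma Pr_not_good_configuration :
  Pr (fun c => ~ good_configuration r w h M n0 N c) <=
  2 * (2 * n%:R * delta ^+ M +
    (M.+1 * n)%:R * (1 - (1 - p) ^+ (t * (6 * h + 2 * k + 3))) ^+ N) +
  2 * (1 - q ^+ 2 * (1 - p) ^+ (2 * W).-1) ^+ m +
  ((2 * W).+1 * (2 * Y).+1)%:R * (((8 * r).+1 * (8 * r).+1) ^ r)%:R * p ^+ r +
  ((2 * k).+1 * (2 * k).+1)%:R * p.
Proof.
have W0 : (0 < W)%N by rewrite /W muln_gt0 addn_gt0 orbT.
have wW : (w <= W)%N by rewrite /W leq_pmull // addn_gt0 orbT.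
pose L := rect (- W%:Z) (- Y%:Z) (2 * W).+1 (2 * Y).+1.
pose near := rect (- k%:Z) (- k%:Z) (2 * k).+1 (2 * k).+1.
pose A1 c := ~ wall_good r w h M n0 N c.
pose A2 (c : configuration) := ~ wall_good r w h M n0 N (c \o reflect).
pose A3 c := ~ exists2 s, (s < m)%N & lid_at W c (- m%:Z + s%:Z).
pose A4 c := ~ exists2 s, (s < m)%N & lid_at W c ((3 * h)%:Z + s%:Z).
pose A5 (c : configuration) := ~ sparse r [seq s <- L | is_occupied (c s)].
pose A6 (c : configuration) := exists2 s, s \in near & c s = Occupied.
apply: (@le_trans _ _ (Pr A1 + (Pr A2 + (Pr A3 + (Pr A4 + (Pr A5 + Pr A6)))))).
  apply: le_trans (_ : _ <= Pr (fun c => A1 c \/ (A2 c \/ (A3 c \/ (A4 c \/ (A5 c \/ A6 c)))))) _.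
    apply: (Pr_mono _ mu_ge0) => c ng; apply: contrapT => H; apply: ng.
    move: H => /not_orP[/contrapT h1 /not_orP[/contrapT h2 /not_orP[/contrapT h3]]].
    by move=> /not_orP[/contrapT h4 /not_orP[/contrapT h5 h6]].
  by do 4 (apply: le_trans (Pr_or _ mu_ge0 _ _) (lerD (lexx _) _)); exact: Pr_or.
have b1 : Pr A1 <= _ := Pr_not_wall_good.
have b2 : Pr A2 = Pr A1.
  apply: (Pr_involution _ A1) => [[x y]|[x y]]; first by rewrite /reflect /= opprK.
  by rewrite /reflect /= !in_box; lia.
have lidB y : - Y%:Z <= y -> y + m%:Z <= (Y.+1)%:Z -> {subset rect (- W%:Z) y (2 * W).+1 m <= Box}.
  by move=> y1 y2 [s1 s2]; rewrite mem_rect in_box /=; lia.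
have b3 : Pr A3 = _ := Pr_no_lid p_ge0 q_ge0 pq_le1 W0
  (lidB (- m%:Z) ltac:(rewrite /Y; lia) ltac:(lia)).
have b4 : Pr A4 = _ := Pr_no_lid p_ge0 q_ge0 pq_le1 W0
  (lidB ((3 * h)%:Z) ltac:(lia) ltac:(rewrite /Y; lia)).
have LB : {subset L <= Box}.
  by move=> [s1 s2]; rewrite mem_rect in_box /=; lia.
have nearB : {subset near <= Box}.
  by move=> [s1 s2]; rewrite mem_rect in_box /= /Y; lia.
have b5 : Pr A5 <= _ := Pr_not_sparse p_ge0 q_ge0 pq_le1 r_gt0 LB.
have b6 : Pr A6 <= _ := Pr_some_occupied p_ge0 q_ge0 pq_le1 nearB.
rewrite !size_rect in b5 b6; rewrite b2 b3 b4; lra.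
Qed.
End GoodProbability.

(** * Numerical estimates *)

Section Asymptotics.
Variable R : realType.
Implicit Types (p q x z : R).

Lemma bernoulli_sub x (n : nat) : 0 <= x <= 1 -> 1 - n%:R * x <= (1 - x) ^+ n.
Proof.
move=> /andP[x0 x1]; elim: n => [|n IH]; first by rewrite mul0r subr0 expr0.
have nx : 0 <= n%:R * x by rewrite mulr_ge0.
rewrite exprS; apply: le_trans (ler_wpM2l _ IH); last by rewrite subr_ge0.
rewrite -[n.+1%:R]/(1 + n)%:R natrD mulrDl mul1r; nra.
Qed.

(** Induction through [(1 - z) * (1 + n.+1 * z) <= 1 + n * z]. The resulting bound [1 / (1 + n * z)]
    takes the place of an exponential one. *)
Lemma pow_sub_mul_le1 z (n : nat) : 0 <= z <= 1 -> (1 - z) ^+ n * (1 + n%:R * z) <= 1.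
Proof.
move=> /andP[z0 z1]; elim: n => [|n IH]; first by rewrite mul0r addr0 expr0 mulr1.
apply: le_trans IH; rewrite exprSr -mulrA ler_wpM2l ?exprn_ge0 ?subr_ge0 //.
have nz : 0 <= n%:R * z by rewrite mulr_ge0.
rewrite -[n.+1%:R]/(1 + n)%:R natrD mulrDl mul1r; nra.
Qed.

Lemma pow_sub_le z (n : nat) (b : R) : 0 <= z <= 1 -> 0 < b -> b <= n%:R * z ->
  (1 - z) ^+ n <= b^-1.
Proof.
move=> z01 b0 bn; rewrite -[leRHS]mul1r ler_pdivlMr //.
apply: le_trans (pow_sub_mul_le1 n z01).
rewrite ler_wpM2l ?exprn_ge0 ?subr_ge0 //; first by case/andP: z01.
by rewrite ler_wpDl.
Qed.

(** As [p * v <= 1 / 2], Bernoulli leaves at least [1 / 2] from [v] factors, so at least [1 / 4]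
    from [2 * v]; hence the even block width. *)
Lemma pow_half p (v s : nat) : 0 <= p -> p * (2 * v)%:R <= 1 ->
  4^-1 ^+ s <= (1 - p) ^+ ((2 * v) * s).
Proof.
move=> p0; rewrite natrM => pv.
have [->|v0] := posnP v; first by rewrite muln0 mul0n expr0; apply: exprn_ile1; lra.
have v1 : 1 <= v%:R :> R by rewrite ler1n.
have p1 : p <= 1 by nra.
have H : 2^-1 <= (1 - p) ^+ v by apply: le_trans (bernoulli_sub v _); lra.
rewrite exprM; apply: lerXn2r; rewrite ?nnegrE ?invr_ge0 ?exprn_ge0 ?subr_ge0 //.
rewrite mulnC exprM; have : 2^-1 ^+ 2 <= ((1 - p) ^+ v) ^+ 2.
  by apply: lerXn2r; rewrite ?nnegrE ?invr_ge0 ?exprn_ge0 ?subr_ge0.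
lra.
Qed.

Lemma linear_le_exp (A : nat) : exists l0, forall l, (l0 <= l)%N -> (A * l.+1 <= 2 ^ l)%N.
Proof.
(* At [4 * A] the right side is [(2 ^ A) ^ 4], at least [A.+1 ^ 4]; afterwards it doubles at each
   step while the left side at most doubles. *)
exists (4 * A)%N => l Al; rewrite -(subnK Al); elim: (l - _)%N => [|e IH].
  have H : (A.+1 <= 2 ^ A)%N by exact: ltn_expl.
  rewrite add0n [in leqRHS]mulnC expnM.
  apply: (@leq_trans (A.+1 ^ 4)); last by rewrite leq_exp2r.
  rewrite !expnS expn0; nia.
rewrite addSn expnS; lia.
Qed.

(** By [1 - p - q <= (1 - p) * (1 - q)] the rate is at least [(1 - p) ^ (3 w) * (1 - (1 - q) ^ w)];
    the first factor is at least [1 / 64] by [pow_half]. *)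
Lemma row_rate_ge p q (v : nat) : 0 <= p -> 0 < q -> p + q <= 1 -> (0 < v)%N ->
  p * (2 * v)%:R <= 1 ->
  64^-1 * ((2 * v)%:R * q / (1 + (2 * v)%:R * q)) <= row_rate p q (2 * v) (2 * (2 * v)).
Proof.
move=> p0 q0 pq v0 pv; set w := (2 * v)%N in pv *.
have w0 : 0 < w%:R :> R by rewrite ltr0n /w; lia.
have [p1 q1] : p <= 1 /\ q <= 1 by lra.
have a1 : 4^-1 <= (1 - p) ^+ w.
  by have := pow_half 1 p0 pv; rewrite expr1 muln1.
have a2 : 16^-1 <= (1 - p) ^+ (2 * w).
  have := pow_half 2 p0 pv; rewrite -/w mulnC.
  by apply: le_trans; rewrite expr2; lra.
have b1 : (1 - p - q) ^+ w <= (1 - p) ^+ w * (1 - q) ^+ w.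
  by rewrite -exprMn; apply: lerXn2r; rewrite ?nnegrE; nra.
have wq : 0 < w%:R * q by rewrite mulr_gt0.
have b2 : (1 - q) ^+ w <= (1 + w%:R * q)^-1.
  rewrite -[leRHS]mul1r ler_pdivlMr; last by lra.
  by apply: pow_sub_mul_le1; lra.
rewrite /row_rate exprD -mulrBl.
have -> : w%:R * q / (1 + w%:R * q) = 1 - (1 + w%:R * q)^-1.
  by field; rewrite gt_eqF //; lra.
set s := (1 + w%:R * q)^-1 in b2 *.
have s1 : s < 1 by rewrite invf_lt1; lra.
set a := (1 - p) ^+ w in a1 b1 *; set b := (1 - p - q) ^+ w in b1 *.
set a' := (1 - p) ^+ (2 * w) in a2 *; set e := (1 - q) ^+ w in b1 b2.
have c1 : 4^-1 * (1 - s) <= a - b by nra.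
nra.
Qed.

Lemma row_rate_le1 p q (w b : nat) : 0 <= p -> 0 <= q -> p + q <= 1 ->
  row_rate p q w b <= 1.
Proof.
move=> p0 q0 pq; rewrite /row_rate.
have : 0 <= (1 - p - q) ^+ w * (1 - p) ^+ b by rewrite mulr_ge0 // exprn_ge0 //; lra.
have : (1 - p) ^+ (w + b) <= 1 by apply: exprn_ile1; lra.
lra.
Qed.

End Asymptotics.

(* [w] is comparable to [1 / p] and [l] to [ln (1 / p)]: columns have height of
   order [w * l / c0] so that one of the [w] columns of a block is empty, and the
   walls have about [w ^ 9] levels so that some row of length [2 * W] is a lid.
   [q_large] makes the failure probability of a cell at most [delta ^+ 2], small
   enough for [delta ^+ l] to beat the number of levels. *)
Section Scales.
Variables (R : realType) (p q : R) (r k t c0 l v : nat).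
Hypotheses (r14 : (14 <= r)%N) (kE : k = (2 * r)%N) (tE : t = (2 * k + 3)%N).
Hypotheses (c0E : c0 = (28 * t)%N) (l49 : (49 <= l)%N).
Hypothesis l_large : (12 * c0 * t * l.+1 <= 2 ^ l)%N.

Local Notation w := (2 * v)%N.
Let h := (w * l)%N.
Let n0 := (w ^ 9)%N.
Let W := ((l + 3) * w)%N.
Let m := (n0 * (3 * h))%N.
Let N := (2 ^ (14 * t * l) * (12 * c0 * l.+1))%N.
Let delta : R := 2^-1 ^+ (24 * c0).

Hypotheses (w_lo : (2 ^ (c0 * l) <= w)%N) (w_hi : (w <= 2 ^ (c0 * l.+1))%N).
Hypotheses (p_gt0 : 0 < p) (q_gt0 : 0 < q) (pq_le1 : p + q <= 1).
Hypotheses (pw_le1 : p * w%:R <= 1) (pw_ge : 1 <= 2 * (p * w%:R)).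
Hypothesis q_large : 512 * 2 ^+ (48 * c0) * p ^+ 2 <= q * l%:R.

Let t_ge3 : (3 <= t)%N. Proof. by rewrite tE leq_addl. Qed.
Let c0_ge84 : (84 <= c0)%N.
Proof. by rewrite c0E -[84%N]/(28 * 3)%N leq_mul2l t_ge3. Qed.
Let l_gt0 : (0 < l)%N. Proof. by rewrite (leq_trans _ l49). Qed.

Lemma scale_exp_le (a : nat) : (a <= c0 * l)%N -> (2 ^ a <= w)%N.
Proof. by move=> al; apply: leq_trans w_lo; rewrite leq_exp2l. Qed.

Lemma scale_linear : (12 * c0 * t * l.+1 <= w)%N.
Proof.
apply: leq_trans l_large _; apply: scale_exp_le.
by rewrite leq_pmull // (leq_trans _ c0_ge84).
Qed.

Lemma scale_bounds : [/\ (32 <= w)%N, (k + 5 <= w)%N, (2 * k + 3 <= w)%N & (l + 3 <= w)%N].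
Proof.
have := scale_linear.
have : (t * l.+1 <= 12 * c0 * t * l.+1)%N.
  by rewrite leq_mul2r leq_pmull ?orbT // muln_gt0 (leq_trans _ c0_ge84).
have : (t <= t * l.+1)%N by rewrite leq_pmulr.
have : (2 * l.+1 <= t * l.+1)%N by rewrite leq_mul2r (ltnW t_ge3) orbT.
by move: l49 r14 kE tE; clear; split; lia.
Qed.

Lemma scale_pow12 : (w ^ 12 <= 2 ^ (12 * c0 * l.+1))%N.
Proof.
have -> : (12 * c0 * l.+1 = c0 * l.+1 * 12)%N by clear; lia.
by rewrite expnM leq_exp2r.
Qed.

Let w32 : (32 <= w)%N. Proof. by case: scale_bounds. Qed.
Let facts : [/\ 0 < p, 0 < q, p + q <= 1, p <= 1 & 32 <= w%:R :> R] /\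
  1 <= p * w%:R * 2.
Proof.
split; last by rewrite mulrC.
by split => //; [move: q_gt0 pq_le1; lra|rewrite ler_nat].
Qed.

Lemma delta_bounds : 0 <= delta /\ 3 * delta <= 2^-1.
Proof.
split; first by rewrite exprn_ge0 // invr_ge0.
have : delta <= 2^-1 ^+ 3.
  apply: ler_wiXn2l; rewrite ?invr_ge0 //; first by lra.
  by apply: (@leq_trans c0); [exact: leq_trans c0_ge84|exact: leq_pmull].
by rewrite !exprS expr0; lra.
Qed.

Lemma deltaX (a : nat) : delta ^+ a = ((2 ^ (24 * c0 * a))%:R)^-1.
Proof. by rewrite /delta -exprM exprVn natrX. Qed.

(** The logarithm is gained here, through the factor [l] in [h]. With [u = w q] and
    [D = delta ^- 2], it suffices that [64 D (1 + u) <= w l u]. For [u >= 1] this follows from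
    [w >= 128 D], ensured by [l >= 49]; for [u < 1] from [q_large] and [p w >= 1 / 2]. *)
Lemma cell_scale : 0 <= (1 - row_rate p q w (2 * w)) ^+ h <= delta ^+ 2.
Proof.
have [[p0 q0 pq p1 w1] pw2] := facts.
have v0 : (0 < v)%N by case: (v) w32.
have rho1 : row_rate p q w (2 * w) <= 1 by apply: row_rate_le1 => //; lra.
rewrite exprn_ge0 ?subr_ge0 //= deltaX.
have := row_rate_ge (ltW p_gt0) q_gt0 pq_le1 v0 pw_le1.
set rho := row_rate _ _ _ _ in rho1 *; set u := w%:R * q => rho_ge.
have u0 : 0 < u by rewrite mulr_gt0 //; lra.
set D : R := (2 ^ (24 * c0 * 2))%:R.
have D1 : 0 < D by rewrite ltr0n expn_gt0.
have DE : D = 2 ^+ (48 * c0) by rewrite /D natrX mulnAC.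
have rho0 : 0 <= rho by apply: le_trans rho_ge; rewrite mulr_ge0 ?divr_ge0 ?invr_ge0 //; lra.
apply: pow_sub_le; rewrite ?rho0 //.
apply: (@le_trans _ _ (h%:R * (64^-1 * (u / (1 + u))))); last by rewrite ler_wpM2l.
rewrite mulrA mulrA ler_pdivlMr; last by lra.
have lR : 1 <= l%:R :> R by rewrite ler1n.
suff : 64 * D * (1 + u) <= w%:R * l%:R * u by rewrite /h natrM; lra.
have [u1|u1] := lerP 1 u.
  have : 128 * D <= w%:R.
    rewrite /D -natrM ler_nat -[128%N]/(2 ^ 7)%N -expnD; apply: scale_exp_le.
    by apply: (@leq_trans (c0 * 49)); [by move: c0_ge84; clear; lia|rewrite leq_mul2l l49 orbT].
  move=> H; have : 128 * D * u <= w%:R * u by rewrite ler_wpM2r // ltW.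
  have : w%:R * u <= w%:R * l%:R * u.
    by rewrite ler_wpM2r ?(ltW u0) // ler_peMr //; lra.
  have : D * (1 + u) <= D * (2 * u) by rewrite ler_wpM2l ?(ltW D1) //; lra.
  lra.
have : D * (1 + u) <= D * 2 by rewrite ler_wpM2l ?(ltW D1) //; lra.
move: q_large; rewrite -DE => ql.
have w2 : 0 <= w%:R ^+ 2 :> R by rewrite exprn_ge0.
have := ler_wpM2l w2 ql.
have e1 : w%:R * l%:R * u = w%:R ^+ 2 * (q * l%:R) by rewrite /u; ring.
have : D * 1 <= D * (4 * (p * w%:R) ^+ 2).
  by rewrite ler_wpM2l ?(ltW D1) // expr2; nra.
have e2 : w%:R ^+ 2 * (512 * D * p ^+ 2) = 128 * (D * (4 * (p * w%:R) ^+ 2)) by ring.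
rewrite e1 e2; lra.
Qed.

(** The exponent 24 in [delta] gives [delta ^+ l <= w ^- 12], as [l.+1 <= 2 * l]; this beats the
    [2 w ^ 9 + 1] levels, with [p >= 1 / (2 w)]. *)
Lemma lipschitz_scale : 2 * (2 * n0).+1%:R * delta ^+ l <= p.
Proof.
have [[p0 q0 pq p1 w1] pw2] := facts.
rewrite deltaX ler_pdivrMr ?ltr0n ?expn_gt0 //.
have H : (w ^ 12 <= 2 ^ (24 * c0 * l))%N.
  apply: leq_trans scale_pow12 _; rewrite leq_exp2l //.
  rewrite (_ : 24 * c0 * l = 12 * c0 * (2 * l))%N; last by clear; lia.
  by rewrite leq_mul2l; apply/orP; right; move: l_gt0; clear; lia.
apply: (@le_trans _ _ (p * (w ^ 12)%:R)); last by rewrite ler_wpM2l ?ler_nat ?ltW.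
have -> : (w ^ 12)%:R = w%:R * (w ^ 11)%:R :> R by rewrite -natrM -expnS.
have H2 : (6 * n0 * 2 <= w ^ 11)%N.
  have -> : (w ^ 11 = n0 * (w * w))%N by rewrite /n0 -[11%N]/(9 + 2)%N expnD.
  rewrite (_ : 6 * n0 * 2 = n0 * 12)%N; last by clear; lia.
  by rewrite leq_mul2l (leq_trans _ (leq_mul w32 w32)) ?orbT.
have n1 : (1 <= n0)%N by rewrite expn_gt0 (leq_trans _ w32).
have H3 : (12 * n0)%:R <= (w ^ 11)%:R :> R by rewrite ler_nat -[12%N]/(6 * 2)%N mulnAC.
have H4 : 1 <= n0%:R :> R by rewrite ler1n.
rewrite -[(2 * n0).+1]addn1 natrD natrM mulrA; rewrite natrM in H3.
set a := p * w%:R in pw2 *; set b := (w ^ 11)%:R in H3 *.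
have : a * 2 * b >= b by rewrite ler_peMl //; lra.
lra.
Qed.

(** A slot has at most [7 t h] sites, so it is free with probability at least [2 ^- (14 t l)]. Hence
    [2 ^ (14 t l)] slots all fail with probability at most [1 / 2], and [12 c0 l.+1] such groups
    with probability at most [w ^- 12]. *)
Lemma column_scale :
  (l.+1 * (2 * n0).+1)%:R * (1 - (1 - p) ^+ (t * (6 * h + 2 * k + 3))) ^+ N <= p.
Proof.
have [[p0 q0 pq p1 w1] pw2] := facts.
have [_ _ k3 _] := scale_bounds.
set z := (1 - p) ^+ _.
have z01 : 0 <= z <= 1 by rewrite exprn_ge0 ?exprn_ile1 //; lra.
set Z := (2 ^ (14 * t * l))%N.
have zZ : 1 <= Z%:R * z.
  have H : 4^-1 ^+ (7 * t * l) <= z.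
    apply: le_trans (pow_half (7 * t * l) (ltW p_gt0) pw_le1) _.
    apply: ler_wiXn2l; [lra|lra|].
    apply: (@leq_trans (t * (7 * h))); last by rewrite /h; clear; lia.
    have hw : (w <= h)%N by rewrite leq_pmulr.
    by rewrite leq_mul2l; apply/orP; right; move: k3 hw; clear; lia.
  apply: (@le_trans _ _ (Z%:R * 4^-1 ^+ (7 * t * l))); last by rewrite ler_wpM2l.
  rewrite /Z (_ : 14 * t * l = 2 * (7 * t * l))%N; last by clear; lia.
  by rewrite expnM natrX -exprMn divff ?expr1n.
have half : (1 - z) ^+ Z <= 2^-1.
  have := pow_sub_mul_le1 Z z01.
  have : 0 <= (1 - z) ^+ Z by rewrite exprn_ge0 //; lra.
  nra.
rewrite /N exprM -/Z.
apply: (@le_trans _ _ ((l.+1 * (2 * n0).+1)%:R * 2^-1 ^+ (12 * c0 * l.+1))).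
  by rewrite ler_wpM2l //; apply: lerXn2r; rewrite ?nnegrE ?exprn_ge0 ?invr_ge0 //; lra.
rewrite exprVn ler_pdivrMr ?exprn_gt0 // -natrX.
apply: (@le_trans _ _ (p * (w ^ 12)%:R)); last by rewrite ler_wpM2l ?ler_nat ?scale_pow12 ?ltW.
have -> : (w ^ 12)%:R = w%:R * (w ^ 11)%:R :> R by rewrite -natrM -expnS.
have H2 : (l.+1 * (2 * n0).+1 * 2 <= w ^ 11)%N.
  have -> : (w ^ 11 = n0 * (w * w))%N by rewrite /n0 -[11%N]/(9 + 2)%N expnD.
  have n1 : (1 <= n0)%N by rewrite expn_gt0 (leq_trans _ w32).
  have [_ _ _ lw] := scale_bounds.
  apply: (@leq_trans (w * (3 * n0) * 2)).
    by rewrite leq_mul2r leq_mul //; [move: lw|move: n1]; clear; lia.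
  have -> : (w * (3 * n0) * 2 = n0 * (w * 6))%N by clear; lia.
  by rewrite leq_mul2l leq_mul2l; apply/orP; right; apply/orP; right; exact: leq_trans w32.
have H3 : (l.+1 * (2 * n0).+1 * 2)%:R <= (w ^ 11)%:R :> R by rewrite ler_nat.
rewrite natrM in H3; rewrite mulrA.
set a := p * w%:R in pw2 *; set b := (w ^ 11)%:R in H3 *.
have b0 : 0 <= b by [].
have : a * 2 * b >= b by rewrite ler_peMl //; lra.
lra.
Qed.

(** By [q_large], [q >= 1 / (4 w ^ 3)], and the unoccupied inner sites cost at most a factor
    [1 / w]: a row is a lid with probability at least [1 / (16 w ^ 7)]. At least [w ^ 9] rows all
    fail with probability at most [16 / w ^ 2 <= p]. *)
Lemma lid_scale : (1 - q ^+ 2 * (1 - p) ^+ (2 * W).-1) ^+ m <= p.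
Proof.
have [[p0 q0 pq p1 w1] pw2] := facts.
have [_ _ _ lw] := scale_bounds.
set y := (1 - p) ^+ (2 * W).-1.
have y01 : 0 <= y <= 1 by rewrite exprn_ge0 ?exprn_ile1 //; lra.
have yw : 1 <= w%:R * y.
  have H : 4^-1 ^+ (2 * (l + 3)) <= y.
    apply: le_trans (pow_half (2 * (l + 3)) (ltW p_gt0) pw_le1) _.
    by apply: ler_wiXn2l; [lra|lra|rewrite /W; clear; lia].
  have H2 : (4 ^ (2 * (l + 3)))%:R <= w%:R :> R.
    rewrite ler_nat -[4%N]/(2 ^ 2)%N -expnM; apply: scale_exp_le.
    apply: (@leq_trans (16 * l)); first by move: l_gt0; clear; lia.
    by rewrite leq_mul2r (leq_trans _ c0_ge84) ?orbT.
  apply: (@le_trans _ _ ((4 ^ (2 * (l + 3)))%:R * 4^-1 ^+ (2 * (l + 3)))).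
    by rewrite natrX -exprMn divff ?expr1n.
  by apply: ler_pM => //; rewrite exprn_ge0 // invr_ge0.
have qw : 1 <= 4 * (q * w%:R ^+ 3).
  have D1 : 1 <= 2 ^+ (48 * c0) :> R by rewrite exprn_ege1 //; lra.
  have ql : p ^+ 2 <= q * w%:R.
    apply: (@le_trans _ _ (q * l%:R)); last first.
      by rewrite ler_wpM2l ?(ltW q_gt0) // ler_nat; move: lw; clear; lia.
    apply: le_trans q_large; rewrite ler_peMl ?exprn_ge0 ?ltW //; lra.
  have : w%:R ^+ 2 * p ^+ 2 <= w%:R ^+ 2 * (q * w%:R) by rewrite ler_wpM2l // exprn_ge0.
  have -> : w%:R ^+ 2 * p ^+ 2 = (p * w%:R) ^+ 2 by ring.
  have -> : w%:R ^+ 2 * (q * w%:R) = q * w%:R ^+ 3 by ring.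
  have : 1 <= 4 * (p * w%:R) ^+ 2 by rewrite expr2; nra.
  lra.
set z := q ^+ 2 * y.
have z01 : 0 <= z <= 1.
  case/andP: y01 => y0 y1; have q1 : q <= 1 by lra.
  have q0' := ltW q0; have q2 : 0 <= q ^+ 2 <= 1 by rewrite exprn_ge0 ?exprn_ile1.
  by case/andP: q2 => ? ?; rewrite mulr_ge0 ?mulr_ile1.
have zw : 1 <= 16 * (w%:R ^+ 7 * z).
  have -> : 16 * (w%:R ^+ 7 * z) = (4 * (q * w%:R ^+ 3)) ^+ 2 * (w%:R * y).
    by rewrite /z; ring.
  by rewrite mulr_ege1 // exprn_ege1.
apply: (@le_trans _ _ ((1 - z) ^+ (w ^ 9))).
  apply: ler_wiXn2l; [lra|lra|].
  by rewrite leq_pmulr // muln_gt0 /= muln_gt0 l_gt0 (leq_trans _ w32).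
apply: (@le_trans _ _ ((w%:R ^+ 2 / 16)^-1)).
  apply: pow_sub_le => //; first by rewrite divr_gt0 // exprn_gt0; lra.
  rewrite natrX; have -> : w%:R ^+ 9 * z = w%:R ^+ 2 * (w%:R ^+ 7 * z) by ring.
  by rewrite ler_wpM2l ?exprn_ge0 //; lra.
rewrite invf_div ler_pdivrMr ?exprn_gt0 //; last by lra.
have -> : p * w%:R ^+ 2 = p * w%:R * w%:R by ring.
nra.
Qed.

Let Y := (m + 6 * h + k + 5)%N.

Lemma box_scale : ((2 * W).+1 * (2 * Y).+1 <= 63 * w ^ 13)%N.
Proof.
have [_ k5 _ lw] := scale_bounds.
have H1 : ((2 * W).+1 <= 3 * w ^ 2)%N.
  have Ww : (W <= w * w)%N by rewrite leq_mul2r lw orbT.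
  have w2 : (0 < w * w)%N by rewrite muln_gt0 (leq_trans _ w32).
  by rewrite -mulnn; move: (w * w)%N (W) Ww w2; clear; lia.
have hw : (h <= w ^ 2)%N by rewrite /h !expnS expn0 muln1 leq_mul2l; move: lw; clear; lia.
have mw : (m <= 3 * w ^ 11)%N.
  have -> : (w ^ 11 = w ^ 9 * w ^ 2)%N by rewrite -expnD.
  by rewrite /m /n0 mulnCA leq_mul2l leq_mul2l hw !orbT.
have w11 : (w ^ 2 <= w ^ 11)%N by rewrite leq_pexp2l // (leq_trans _ w32).
have w1 : (w ^ 1 <= w ^ 11)%N by rewrite leq_pexp2l // (leq_trans _ w32).
have H2 : ((2 * Y).+1 <= 21 * w ^ 11)%N.
  rewrite /Y; rewrite expn1 in w1.
  by move: (m) (h) (w ^ 11)%N (w ^ 2)%N mw hw w11 w1 k5; clear; lia.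
by apply: leq_trans (leq_mul H1 H2) _; rewrite mulnACA -expnD.
Qed.

(** The box has at most [63 w ^ 13] sites and [p w <= 1], so the fourteenth power of [p] leaves one
    factor [p]: this is why [r >= 14]. *)
Lemma sparse_scale (a : R) : 0 <= a ->
  ((2 * W).+1 * (2 * Y).+1)%:R * a * p ^+ r <= 63 * a * p.
Proof.
have [[p0 q0 pq p1 w1] pw2] := facts.
have p0' := ltW p0.
move=> a0; apply: (@le_trans _ _ (63 * w%:R ^+ 13 * a * p ^+ 14)).
  apply: ler_pM; [by rewrite mulr_ge0|by rewrite exprn_ge0| |by apply: ler_wiXn2l].
  by rewrite ler_wpM2r // -natrX -natrM ler_nat box_scale.
have -> : 63 * w%:R ^+ 13 * a * p ^+ 14 = 63 * a * p * (p * w%:R) ^+ 13 by ring.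
by rewrite ler_piMr ?mulr_ge0 // exprn_ile1 // mulr_ge0.
Qed.

(** [c0 = 28 t] leaves [2 ^ (14 t l)] twice: once for the slots of a group, once to absorb the
    number of groups and the width [t]. *)
Lemma columns_fit : (N * t <= w)%N.
Proof.
apply: (@leq_trans (2 ^ (14 * t * l) * 2 ^ (14 * t * l))); last first.
  by rewrite -expnD; apply: scale_exp_le; rewrite c0E; clear; lia.
rewrite /N -mulnA leq_mul2l; apply/orP; right.
have -> : (12 * c0 * l.+1 * t = 12 * c0 * t * l.+1)%N by clear; lia.
by apply: leq_trans l_large _; rewrite leq_exp2l // leq_pmull // muln_gt0 (leq_trans _ t_ge3).
Qed.

Lemma Pr_not_good_scale :
  Pr (site_law p q) (box W Y) (fun c => ~ good_configuration r w h l n0 N c) <=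
  (6 + 63 * (((8 * r).+1 * (8 * r).+1) ^ r)%:R + ((2 * k).+1 * (2 * k).+1)%:R) * p.
Proof.
have [[p0 q0 pq p1 w1] pw2] := facts.
have [d0 d3] := delta_bounds; have [_ k5 _ _] := scale_bounds.
have fit := columns_fit.
have r_gt0 : (0 < r)%N by rewrite (leq_trans _ r14).
have kw : (k <= w)%N by apply: leq_trans k5; rewrite leq_addr.
have w_gt0 : (0 < w)%N by rewrite (leq_trans _ w32).
have := @Pr_not_good_configuration R p q delta r w h l n0 N
  (ltW p_gt0) (ltW q_gt0) pq_le1.
rewrite -!kE -tE -/W -/m -/Y => /(_ r_gt0 fit kw w_gt0 d0 d3 cell_scale).
move=> /le_trans; apply.
have := lipschitz_scale; have := column_scale; have := lid_scale.
have := @sparse_scale (((8 * r).+1 * (8 * r).+1) ^ r)%:R (ler0n _ _).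
lra.
Qed.
End Scales.

(** * Choice of the scales *)

Lemma choose_scale (R : realType) (p : R) (c0 l1 : nat) :
  (0 < c0)%N -> 0 < p -> p * (4 * 2 ^ (c0 * l1))%:R < 1 ->
  exists v l : nat,
    [/\ (l1 <= l)%N, (2 ^ (c0 * l) <= 2 * v <= 2 ^ (c0 * l.+1))%N,
        p * (2 * v)%:R <= 1 & 1 <= 2 * (p * (2 * v)%:R)].
Proof.
move=> c0_gt0 p0; set E := (2 ^ (c0 * l1))%N => pE.
have E1 : (1 <= E)%N by rewrite expn_gt0.
(* [2 * v] approximates [1 / p]; below, [l] is the integer part of its binary logarithm divided by
   [c0]. *)
pose v := Num.truncn (2 * p)^-1.
have p2 : 0 < 2 * p by rewrite mulr_gt0.
have /andP[v1 v2] : v%:R <= (2 * p)^-1 < v.+1%:R.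
  by apply: truncn_itv; rewrite invr_ge0 ltW.
rewrite -[leRHS]mul1r ler_pdivlMr // in v1.
rewrite -[ltLHS]mul1r ltr_pdivrMr // in v2.
have vE : (E <= v)%N.
  rewrite -ltnS -(ltr_nat R); move: pE v2; rewrite natrM.
  set e := E%:R; set u := v.+1%:R => pE v2.
  have : p * (4 * e) < p * (2 * u) by lra.
  have e0 : 0 <= e by exact: ler0n.
  rewrite ltr_pM2l // => eu; lra.
have vR : 1 <= v%:R :> R by rewrite ler1n; exact: leq_trans vE.
pose T := trunc_log 2 (2 * v).
have v0 : (0 < 2 * v)%N by rewrite muln_gt0 /=; exact: leq_trans vE.
have /andP[T1 T2] := trunc_log_bounds (isT : (1 < 2)%N) v0; rewrite -/T in T1 T2.
exists v, (T %/ c0)%N; split.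
- rewrite leq_divRL //; apply: trunc_log_max => //.
  by rewrite mulnC; apply: (leq_trans vE); rewrite leq_pmull.
- apply/andP; split.
    by apply: leq_trans T1; rewrite leq_exp2l // mulnC leq_divM.
  apply: leq_trans (ltnW T2) _; rewrite leq_exp2l // mulnC.
  exact: ltn_ceil.
- by rewrite natrM; lra.
- move: v2; rewrite natrM -addn1 natrD; nra.
Qed.

(** Since [1 / p] is at most twice [2 * v], it is at most [2 ^ (c0 * l.+1 + 1)]. This trades the
    hypothesis on [ln (1 / p)] for one on [l]. *)
Lemma ln_scale (R : realType) (p : R) (c0 l v : nat) :
  (0 < c0)%N -> (0 < l)%N -> 0 < p -> (2 * v <= 2 ^ (c0 * l.+1))%N ->
  1 <= 2 * (p * (2 * v)%:R) -> ln (1 / p) <= (6 * c0 * l)%:R.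
Proof.
move=> c0_gt0 l0 p0 v_hi pv.
have H : 1 / p <= 2 ^+ (c0 * l.+1).+1.
  rewrite ler_pdivrMr // exprS -natrX.
  have : (2 * v)%:R <= (2 ^ (c0 * l.+1))%:R :> R by rewrite ler_nat.
  set a := (2 * v)%:R in pv *; set b := _%:R => ab; nra.
have : ln (1 / p) <= ln (2 ^+ (c0 * l.+1).+1).
  by rewrite ler_ln ?posrE ?divr_gt0 ?exprn_gt0.
move=> /le_trans; apply; rewrite lnXn // -[ln 2 *+ _]mulr_natr.
have ln2 : ln 2 <= 2 :> R by apply/ltW/ln_sublinear.
apply: (@le_trans _ _ (2 * (c0 * l.+1).+1%:R)); first by rewrite ler_wpM2r.
rewrite -natrM ler_nat; nia.
Qed.

Lemma Pr_not_good_small (R : realType) : exists C A p0 : R,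
  [/\ 0 < C, 0 < A, 0 < p0 < 1 & forall p q, 0 < p < p0 -> 0 < q -> p + q <= 1 ->
    C * p ^+ 2 / ln (1 / p) <= q ->
    exists r w h M n0 N : nat,
      [/\ [/\ (1 < r)%N, (0 < n0)%N, (0 < h)%N & (0 < w)%N], (N * (2 * (2 * r) + 3) <= w)%N &
      Pr (site_law p q)
        (box ((M + 3) * w) (n0 * (3 * h) + 6 * h + 2 * r + 5))
        (fun c => ~ good_configuration r w h M n0 N c) <= A * p]].
Proof.
have [r r14] : exists r, (14 <= r)%N by exists 14%N.
have [k kE] : exists k, k = (2 * r)%N by eexists.
have [t tE] : exists t, t = (2 * k + 3)%N by eexists.
have [c0 c0E] : exists c, c = (28 * t)%N by eexists.
have t3 : (3 <= t)%N by rewrite tE leq_addl.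
have c0_gt0 : (0 < c0)%N by rewrite c0E muln_gt0 (leq_trans _ t3).
have [l0 l0P] := linear_le_exp (12 * c0 * t).
pose l1 := maxn l0 49.
pose E : R := (4 * 2 ^ (c0 * l1))%:R.
have E1 : 1 < E.
  by rewrite ltr1n (@leq_trans (4 * 1)) // leq_mul2l expn_gt0.
have E0 : 0 < E by exact: lt_trans E1.
pose D : R := 512 * 2 ^+ (48 * c0).
have D0 : 0 < D by apply: mulr_gt0; [rewrite ltr0n|apply: exprn_gt0; rewrite ltr0n].
pose A : R := 6 + 63 * (((8 * r).+1 * (8 * r).+1) ^ r)%:R + ((2 * k).+1 * (2 * k).+1)%:R.
(* [D] is the constant of [q_large], [6 * c0] comes from [ln_scale], and [p < E^-1] makes
   [choose_scale] return [l >= l1]. *)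
exists ((6 * c0)%:R * D), A, E^-1; split.
- by rewrite mulr_gt0 // ltr0n muln_gt0.
- have a1 : 0 <= (((8 * r).+1 * (8 * r).+1) ^ r)%:R :> R := ler0n _ _.
  have a2 : 0 <= ((2 * k).+1 * (2 * k).+1)%:R :> R := ler0n _ _.
  by rewrite /A; lra.
- by rewrite invr_gt0 E0 invf_lt1.
move=> p q /andP[p0 pE] q0 pq pql.
have pE1 : p * E < 1.
  by rewrite -ltr_pdivlMr ?div1r.
have [v [l [l1l /andP[w_lo w_hi] pw pw2]]] := choose_scale c0_gt0 p0 pE1.
have l49 : (49 <= l)%N by apply: leq_trans l1l; exact: leq_maxr.
have l_large : (12 * c0 * t * l.+1 <= 2 ^ l)%N.
  by apply: l0P; apply: leq_trans l1l; exact: leq_maxl.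
have lgt0 : (0 < l)%N by rewrite (leq_trans _ l49).
have lnp := ln_scale c0_gt0 lgt0 p0 w_hi pw2.
have p1 : p < 1 by rewrite (lt_le_trans pE) // invf_le1 // ltW.
have ln0 : 0 < ln (1 / p) by apply: ln_gt0; rewrite div1r invf_gt1.
have ql : D * p ^+ 2 <= q * l%:R.
  have c00 : 0 < (6 * c0)%:R :> R by rewrite ltr0n muln_gt0.
  move: pql; rewrite ler_pdivrMr // => pql.
  rewrite -(ler_pM2l c00) mulrA; apply: (le_trans pql).
  rewrite [leRHS]mulrCA -natrM; by rewrite ler_wpM2l // ltW.
exists r, (2 * v)%N, (2 * v * l)%N, l, ((2 * v) ^ 9)%N,
  (2 ^ (14 * t * l) * (12 * c0 * l.+1))%N; split.
- have v0 : (0 < 2 * v)%N by apply: leq_trans w_lo; rewrite expn_gt0.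
  by split; [exact: leq_trans r14|rewrite expn_gt0 v0|rewrite muln_gt0 v0|].
- by rewrite -kE -tE; exact: columns_fit tE c0E l_large w_lo.
- by rewrite -kE; exact: (Pr_not_good_scale r14 kE tE c0E l49 l_large w_lo w_hi p0 q0 pq pw pw2 ql).
Qed.

(** * From small [p] to small [q] *)

Theorem theorem1p1 (R : realType) :
  exists2 C : R, 0 < C &
    forall eta : R, 0 < eta ->
    exists2 q0 : R, 0 < q0 &
      forall p q : R,
        0 < p < 1 -> 0 < q < q0 -> p + q <= 1 ->
        C * p ^+ 2 / ln (1 / p) <= q ->
        forall (d : measure_display) (Omega : measurableType d)
          (P : probability Omega R) (X : site -> {RV P >-> state}),
          polluted_initial_law p q X ->
          (P [set w | eventually_occupied (fun x => X x w) origin]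
             <= eta%:E)%E.
Proof.
have [C [A [p0 [C0 A0 /andP[p00 p01] bound]]]] := Pr_not_good_small R.
exists C => // eta eta0.
(* [p < eta / A] brings the failure bound [A * p] below [eta]. *)
pose p1 := Num.min p0 (eta / A).
have p10 : 0 < p1 by rewrite lt_min p00 divr_gt0.
have p1p0 : p1 <= p0 by rewrite ge_min lexx.
have ln_pos x : 0 < x < 1 -> 0 < ln (1 / x) :> R.
  by move=> /andP[x0 x1]; apply: ln_gt0; rewrite div1r invf_gt1.
have lnp1 : 0 < ln (1 / p1) by apply: ln_pos; rewrite p10 (le_lt_trans p1p0).
exists (C * p1 ^+ 2 / ln (1 / p1)).
  by rewrite divr_gt0 // mulr_gt0 // exprn_gt0.
move=> p q /andP[pgt0 plt1] /andP[qgt0 qlt] pq pql d Omega P X law.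
(* [p ^+ 2 / ln (1 / p)] increases on [(0, 1)], so [p1 <= p] would force [q] to reach the chosen
   threshold. *)
have pp1 : p < p1.
  rewrite ltNge; apply/negP => p1p.
  have lnp : 0 < ln (1 / p) by apply: ln_pos; rewrite pgt0.
  have : C * p1 ^+ 2 / ln (1 / p1) <= C * p ^+ 2 / ln (1 / p).
    apply: ler_pM.
    - by rewrite mulr_ge0 ?exprn_ge0 // ltW.
    - by rewrite invr_ge0 ltW.
    - by rewrite ler_wpM2l ?(ltW C0) // lerXn2r ?nnegrE // ltW.
    - rewrite lef_pV2 ?posrE // ler_ln ?posrE ?divr_gt0 //.
      by rewrite !div1r lef_pV2 ?posrE.
  by move=> /le_lt_trans/(_ (le_lt_trans pql qlt)); rewrite ltxx.
have pr : 0 < p < p0 by rewrite pgt0 (lt_le_trans pp1).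
have [r [w [h [M [n0 [N [[r1 n00 h0 w0] Nw Prb]]]]]]] := bound p q pr qgt0 pq pql.
pose Box := box ((M + 3) * w) (n0 * (3 * h) + 6 * h + 2 * r + 5).
have PE := @prob_le_Pr R p q d Omega P X Box law
  [set w | eventually_occupied (fun x => X x w) origin]
  (fun c => ~ good_configuration r w h M n0 N c).
apply: le_trans (PE _ _) _.
- exact: measurable_eventually_occupied.
- move=> z occ good.
  have [V [Vst V0 VB]] := good_configuration_safe h0 w0 Nw r1 n00 good.
  suff : stable_set (fun x => X x z) V by move=> /stable_not_occupied /(_ V0); apply.
  move=> x y Vxy; have [c1 c2] := Vst _ _ Vxy.
  (* [V] lies in [Box], where the extended restriction agrees with the configuration, so stability
     carries over. *)
  have cE : extend [ffun t : Box => X (val t) z] (x, y) = X (x, y) z.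
    rewrite -[(x, y)]/(val [` (VB x y Vxy : (x, y) \in Box)]%fset) extend_val.
    by rewrite ffunE.
  by rewrite cE in c1 c2; split.
- rewrite lee_fin; apply: (le_trans Prb).
  have : p <= eta / A by rewrite ltW // (lt_le_trans pp1) // ge_min lexx orbT.
  by rewrite ler_pdivlMr // mulrC.
Qed.
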